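(* Let $\varepsilon\ge 0$, let $M$ be a closed surface (dimension $2$) and let $g(t)$, $t\in[0,T)$, be a solution to the $\varepsilon$-Ricci flow $$\frac{\partial}{\partial t}g_{ij}=-\varepsilon R\,g_{ij}$$ on $M$ with $R>0$. Let $f$ be a positive solution on $M\times[0,T)$ to the nonlinear heat equation $$\frac{\partial}{\partial t}f=\Delta f-f\ln f+\varepsilon R f .$$ Put $u=-\ln f$ and $H_\varepsilon=\Delta u-\varepsilon R$. Then for all $t\in(0,T)$, $$H_\varepsilon\le \frac1t ,$$ i.e. $$\frac{\partial}{\partial t}\ln f-|\nabla\ln f|^2+\ln f+\frac1t=\Delta\ln f+\varepsilon R+\frac1t\ge 0 .$$
   Context: A closed surface is a compact 2-dimensional manifold without boundary. At each time $t$, $R$, $\Delta$, $\nabla$ and $|\cdot|$ denote the scalar curvature, the Laplace–Beltrami operator, the gradient and the norm of the metric $g(t)$. Solutions are smooth. *)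

(* Defs.v *)
From mathcomp Require Import all_boot all_order all_algebra.
From mathcomp Require Import all_classical all_reals all_analysis.

Set Implicit Arguments.
Unset Strict Implicit.
Unset Printing Implicit Defensive.

Import Order.TTheory GRing.Theory Num.Theory.
Import numFieldNormedType.Exports.

Local Open Scope classical_set_scope.
Local Open Scope ring_scope.

(* Over a finite-dimensional [V], existence and continuity on the open set [U]
   of all iterated directional derivatives of order at most [k] is the usual
   notion of being of class C^k. *)
Fixpoint Ck (R : realType) (V W : normedModType R) (k : nat) (U : set V)
    (F : V -> W) : Prop :=
  (forall x, U x -> {for x, continuous F}) /\
  match k with
  | 0%N => True
  | k'.+1 => forall v : V,
      (forall x, U x -> derivable F x v) /\ Ck k' U (fun x => 'D_v F x)
  end.

(* Smoothness on a set [A] that need not be open: [F] extends, near each point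
   of [A], to a smooth function on an open set. For open [A] this is C^oo; for
   [A] = [0, T) x U it is smoothness up to the initial time. *)
Definition smooth_on (R : realType) (V W : normedModType R) (A : set V)
    (F : V -> W) : Prop :=
  forall x, A x -> exists (U : set V) (G : V -> W),
    [/\ open U, U x, (forall k, Ck k U G) & {in U `&` A, G =1 F}].

(* A smooth surface without boundary is given by a (not necessarily maximal)
   smooth atlas; [cmap i] is a homeomorphism, with inverse [cinv i], from the
   open set [dom i] onto an open set of the plane. The values of [cmap i] and
   [cinv i] outside [dom i] and [cmap i @` dom i] are irrelevant. *)
Record surface (R : realType) := Surface {
  carrier :> topologicalType;
  chart : Type;
  dom : chart -> set carrier;
  cmap : chart -> carrier -> 'rV[R]_2;
  cinv : chart -> 'rV[R]_2 -> carrier;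
  surface_hausdorff : hausdorff_space carrier;
  surface_second_countable : @second_countable carrier;
  dom_cover : forall p, exists i, dom i p;
  open_dom : forall i, open (dom i);
  open_codom : forall i, open (cmap i @` dom i);
  cmap_continuous : forall i, {within dom i, continuous (cmap i)};
  cinv_continuous : forall i, {within cmap i @` dom i, continuous (cinv i)};
  cmapK : forall i, {in dom i, cancel (cmap i) (cinv i)};
  transition_smooth : forall i j,
        smooth_on (cmap i @` (dom i `&` dom j)) (cmap j \o cinv i)
}.

Arguments dom {R M} i : rename.
Arguments cmap {R M} i : rename.
Arguments cinv {R M} i : rename.

Definition closed_surface (R : realType) (M : surface R) : Prop :=
  compact [set: M].

Section LocalCoordinates.
Variable R : realType.
Implicit Types (F : 'rV[R]_2 -> R) (G : 'rV[R]_2 -> 'M[R]_2) (x : 'rV[R]_2).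

Definition pd (i : 'I_2) F x : R := 'D_(delta_mx 0 i) F x.

(* [christoffel G k i j] is Gamma^k_ij; [ricci G] is the contraction R^k_ikj,
   positive on the round sphere. *)
Definition christoffel G (k i j : 'I_2) x : R :=
  2^-1 * \sum_(l < 2) invmx (G x) k l *
    (pd i (fun y => G y j l) x + pd j (fun y => G y i l) x
     - pd l (fun y => G y i j) x).

Definition ricci G (i j : 'I_2) x : R :=
  \sum_(k < 2) (pd k (christoffel G k i j) x - pd j (christoffel G k i k) x)
  + \sum_(k < 2) \sum_(l < 2)
      (christoffel G k k l x * christoffel G l i j x
       - christoffel G k j l x * christoffel G l i k x).

Definition scalar_curvature G x : R :=
  \sum_(i < 2) \sum_(j < 2) invmx (G x) i j * ricci G i j x.

Definition hessian G F (i j : 'I_2) x : R :=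
  pd i (pd j F) x - \sum_(k < 2) christoffel G k i j x * pd k F x.

Definition laplacian G F x : R :=
  \sum_(i < 2) \sum_(j < 2) invmx (G x) i j * hessian G F i j x.

Definition gradient G F x : 'rV[R]_2 :=
  \row_i \sum_(j < 2) invmx (G x) i j * pd j F x.

Definition sqnorm G x (v : 'rV[R]_2) : R :=
  \sum_(i < 2) \sum_(j < 2) G x i j * v 0 i * v 0 j.

End LocalCoordinates.

(* [g i x] is the matrix of components, at the point of coordinates [x], of a
   symmetric 2-tensor field in the chart [i]. *)
Definition tensor (R : realType) (M : surface R) :=
  chart M -> 'rV[R]_2 -> 'M[R]_2.

Section Surface.
Variables (R : realType) (M : surface R).
Implicit Types (g : tensor M) (i j : chart M) (h : M -> R) (p : M).

Definition transition i j (b : 'I_2) : 'rV[R]_2 -> R :=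
  fun x => cmap j (cinv i x) 0 b.

Definition tensorial g : Prop :=
  forall i j p, dom i p -> dom j p -> forall a b : 'I_2,
    g i (cmap i p) a b =
    \sum_(c < 2) \sum_(d < 2)
      pd a (transition i j c) (cmap i p) * pd b (transition i j d) (cmap i p)
      * g j (cmap j p) c d.

Definition positive_definite (A : 'M[R]_2) : Prop :=
  A^T = A /\ forall v : 'rV[R]_2, v != 0 -> 0 < (v *m A *m v^T) 0 0.

(* Geometric quantities at a point of [dom i], computed in the chart [i]. For
   a metric [g] their values do not depend on [i]. *)
Definition scal g i p : R := scalar_curvature (g i) (cmap i p).

Definition lap g i h p : R := laplacian (g i) (h \o cinv i) (cmap i p).

Definition sqnorm_grad g i h p : R :=
  sqnorm (g i) (cmap i p) (gradient (g i) (h \o cinv i) (cmap i p)).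

End Surface.

Section TimeDependent.
Variables (R : realType) (T : \bar R).

Definition lifespan : set R := [set t | 0 <= t /\ (t%:E < T)%E].

(* The time derivative relative to [0, T): one-sided at the initial time.
   The limit exists for the smooth quantities it is applied to below. *)
Definition dt (h : R -> R) (t : R) : R :=
  lim ((s - t)^-1 * (h s - h t) @[s --> within lifespan t^']).

Definition spacetime (U : set 'rV[R]_2) : set (R * 'rV[R]_2) :=
  [set z | lifespan z.1 /\ U z.2].

Variable M : surface R.

Definition smooth_function (f : R -> M -> R) : Prop :=
  forall i : chart M, smooth_on (spacetime (cmap i @` dom i))
    (fun z : R * 'rV[R]_2 => f z.1 (cinv i z.2)).

Definition smooth_metrics (g : R -> tensor M) : Prop :=
  [/\ forall t, lifespan t -> tensorial (g t),
      forall t, lifespan t -> forall (i : chart M) (p : M), dom i p ->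
        positive_definite (g t i (cmap i p))
    & forall (i : chart M) (a b : 'I_2),
        smooth_on (spacetime (cmap i @` dom i))
          (fun z : R * 'rV[R]_2 => g z.1 i z.2 a b)].

Definition eps_ricci_flow (eps : R) (g : R -> tensor M) : Prop :=
  smooth_metrics g /\
  forall t, lifespan t -> forall (i : chart M) (p : M), dom i p ->
  forall a b : 'I_2,
    dt (fun s => g s i (cmap i p) a b) t =
    - eps * scal (g t) i p * g t i (cmap i p) a b.

Definition heat_solution (eps : R) (g : R -> tensor M) (f : R -> M -> R) :
    Prop :=
  smooth_function f /\
  forall t, lifespan t -> forall (i : chart M) (p : M), dom i p ->
    dt (fun s => f s p) t =
    lap (g t) i (f t) p - f t p * ln (f t p) + eps * scal (g t) i p * f t p.

End TimeDependent.

(* Main.v *)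
(* Let w = ln R (with al = eps, ga = 0) or w = ln f (with al = 1, ga = -1) and
   K = al Lap w + eps R, so that w_t = K + al |dw|^2 + ga w. Since the flow is
   conformal, R_t = eps (Lap R + R^2) and (Lap w)_t = Lap w_t + eps R Lap w;
   with Bochner's formula and 2 |Hess w|^2 >= (Lap w)^2 this gives, where
   dK = 0 and Lap K >= 0,
     K_t >= al^2 ((Lap w)^2 + R |dw|^2) - 2 al eps <dw, dR> + al eps R Lap w
            + al ga Lap w + eps^2 (Lap R + R^2).
   For w = ln R the right-hand side is exactly K^2, hence
   Q := eps (Lap ln R + R) >= -1/t. For w = ln f it is
     |R dw - eps dR|^2 / R + K^2 + eps R (Q - K) - K + eps R,
   which is at least K^2 wherever K < -1/t <= Q. In both cases the maximum
   principle gives K >= -1/t.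
   The independence of K from the chart comes from K = w_t - al |dw|^2 - ga w,
   in which only first derivatives in space occur, and that of eps R from the
   flow equation. The initial time is avoided by proving K >= -1/(t - tau) for
   every tau > 0. *)
Require Import Defs.
From mathcomp Require Import all_boot all_order all_algebra.
From mathcomp Require Import all_classical all_reals all_analysis.
From mathcomp Require Import ring lra.
Import Order.TTheory GRing.Theory Num.Theory.
Import numFieldNormedType.Exports.

Set Implicit Arguments.
Unset Strict Implicit.
Unset Printing Implicit Defensive.

Local Open Scope classical_set_scope.
Local Open Scope ring_scope.

(** * Symmetry of second derivatives *)

(** The identities are computed inside one chart, whereas the minimum is taken over the whole
    surface. Showing directly that second-order quantities such as Lap w and R agree in two charts
    would involve second and third derivatives of the transition maps; expressing K by first
    derivatives, and R by the flow, leaves only a chain rule of first order. Inside a chart the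
    metric, R, w and K are kept as separate families of partial derivatives, tied by equations that
    hold on an open set of space-time. Such equations may be differentiated, and K enters the
    computation as one function instead of an expression of second order in w and the metric. Both
    estimates are instances of one statement with parameters al and ga, and the estimate for ln R is
    used inside the one for ln f, at the points where K < -1/t. For eps = 0 that first estimate is
    not at hand, because eps is divided out to compare R in two charts; but then Q = 0, and K <= 0
    is enough. *)

Lemma is_derive_affine (R : realType) (V W : normedModType R) (A : W -> V)
    (F : V -> R) (y w : W) (v : V) (l : R) :
  (forall h : R, A (h *: w + y) = h *: v + A y) ->
  is_derive (A y) v F l -> is_derive y w (F \o A) l.
Proof.
move=> hA [dF vF].
have E : (fun h : R => h^-1 *: (((F \o A) \o shift y) (h *: w) - (F \o A) y)) =
         (fun h : R => h^-1 *: ((F \o shift (A y)) (h *: v) - F (A y))).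
  by apply/funext => h /=; rewrite hA.
by split; [rewrite /derivable E | rewrite /derive E].
Qed.

Lemma is_derive_line (R : realType) (V : normedModType R) (F : V -> R)
    (x v : V) (s l : R) :
  is_derive (x + s *: v) v F l -> is_derive s 1 (fun r => F (x + r *: v)) l.
Proof.
apply: (@is_derive_affine _ _ _ (fun r : R => x + r *: v)) => h.
by rewrite scalerDl [h *: 1]mulr1 addrCA.
Qed.

Lemma is_derive_of_line (R : realType) (V : normedModType R) (F : V -> R)
    (x v : V) (l : R) :
  is_derive (0 : R) 1 (fun r => F (x + r *: v)) l -> is_derive x v F l.
Proof.
have E : (fun h : R => h^-1 *: (((fun r => F (x + r *: v)) \o shift 0) (h *: 1)
      - F (x + (0 : R) *: v))) = (fun h => h^-1 *: ((F \o shift x) (h *: v) - F x)).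
  by apply/funext => h /=; rewrite [h *: 1]mulr1 addr0 scale0r addr0 (addrC x).
by move=> [+ <-]; rewrite /derivable /derive E.
Qed.

(** Absolute values replace the order of [a] and [b], so that increments of either sign are
    covered. *)
Lemma mean_value (R : realType) (phi dphi : R -> R) (a b : R) :
  (forall r, `|r - a| <= `|b - a| -> is_derive r 1 phi (dphi r)) ->
  exists2 c, `|c - a| <= `|b - a| & phi b - phi a = dphi c * (b - a).
Proof.
have main (f df : R -> R) (x y : R) : x <= y ->
    (forall r, x <= r <= y -> is_derive r 1 f (df r)) ->
    exists2 c, x <= c <= y & f y - f x = df c * (y - x).
  move=> xy H; have [||c] := @MVT_segment _ f df x y xy.
  - by move=> r rI; apply: H; rewrite !(itvP rI).
  - apply: derivable_within_continuous => r rI; apply: ex_derive.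
    by apply: H; rewrite !(itvP rI).
  - by move=> cI; exists c => //; rewrite !(itvP cI).
move=> H; have [ab|/ltW ba] := leP a b.
- have [|c /andP[ac cb] E] := main phi dphi _ _ ab.
    by move=> r /andP[ar rb]; apply: H; rewrite !ger0_norm ?subr_ge0//; lra.
  by exists c => //; rewrite !ger0_norm ?subr_ge0//; lra.
- have [|c /andP[ac cb] E] := main phi dphi _ _ ba.
    by move=> r /andP[ar rb]; apply: H; rewrite !ler0_norm ?subr_le0//; lra.
  by exists c; [rewrite !ler0_norm ?subr_le0//; lra | lra].
Qed.

Section Schwarz.
Variables (R : realType) (V : normedModType R).
Implicit Types (F : V -> R) (x v w : V).

Lemma near_plane (P : set V) x v w : nbhs x P ->
  exists2 d : R, 0 < d &
    forall r s : R, `|r| < d -> `|s| < d -> P (x + r *: v + s *: w).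
Proof.
move=> xP; pose h (z : R * R) := x + z.1 *: v + z.2 *: w.
have hc : {for (0, 0), continuous h}.
  apply: (@continuousD _ _ _ (fun z : R * R => x + z.1 *: v)
    (fun z : R * R => z.2 *: w)).
    apply: (@continuousD _ _ _ (fun=> x) (fun z : R * R => z.1 *: v)).
      exact: cvg_cst.
    apply: (@continuousZl _ _ _ (fst : R * R -> R)); exact: cvg_fst.
  apply: (@continuousZl _ _ _ (snd : R * R -> R)); exact: cvg_snd.
have : nbhs (0 : R, 0 : R) (h @^-1` P).
  by apply: hc; rewrite /h /= !scale0r !addr0.
move=> /nbhs_ballP[d d0 dP]; exists d => // r s rd sd; apply: (dP (r, s)).
by split; rewrite /ball /= sub0r normrN.
Qed.

Lemma continuous_near (F : V -> R) x (e : R) : {for x, continuous F} -> 0 < e ->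
  \forall z \near x, `|F z - F x| < e.
Proof.
move=> Fx e0; have /cvgrPdist_lt/(_ e e0) := Fx.
by apply: filterS => z /=; rewrite distrC.
Qed.

(* The mean value theorem is applied first along [v] and then along [w]. *)
Let second_difference F (U : set V) x v w (e : R) : open U -> U x ->
  (forall z, U z -> derivable F z v) ->
  (forall z, U z -> derivable ('D_v F) z w) ->
  {for x, continuous ('D_w ('D_v F))} -> 0 < e ->
  exists2 d : R, 0 < d & forall s : R, 0 < s < d ->
    `|(F (x + s *: v + s *: w) - F (x + s *: v) - F (x + s *: w) + F x)
      / (s * s) - 'D_w ('D_v F) x| < e.
Proof.
move=> oU Ux dF ddF cF e0.
have [d d0 dP] := @near_plane _ x v w
  (filterI (open_nbhs_nbhs (conj oU Ux)) (continuous_near cF e0)).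
exists d => // s /andP[s0 sd].
pose phi (r : R) := F (x + r *: v + s *: w) - F (x + r *: v).
have sI (r : R) : `|r - 0| <= `|s - 0| -> `|r| < d.
  by rewrite !subr0 => /le_lt_trans; apply; rewrite gtr0_norm.
have sd' : `|s| < d by rewrite gtr0_norm.
have [|r rs Er] := @mean_value R phi
  (fun r => 'D_v F (x + r *: v + s *: w) - 'D_v F (x + r *: v)) 0 s.
  move=> r /sI rd; apply: is_deriveB.
    rewrite (_ : (fun r => F _) = fun r => F (x + s *: w + r *: v)); last first.
      by apply/funext => q; rewrite addrAC.
    apply: is_derive_line; rewrite addrAC; apply: derivableP; apply: dF.
    by have [] := dP r s rd sd'.
  apply: is_derive_line; apply: derivableP; apply: dF.
  have [] := dP r 0 rd; first by rewrite normr0.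
  by rewrite scale0r addr0.
have rd := sI _ rs.
have [|c cs Ec] := @mean_value R (fun c => 'D_v F (x + r *: v + c *: w))
  (fun c => 'D_w ('D_v F) (x + r *: v + c *: w)) 0 s.
  move=> c /sI cd; apply: (@is_derive_line _ _ ('D_v F)).
  by apply: derivableP; apply: ddF; have [] := dP r c rd cd.
have -> : F (x + s *: v + s *: w) - F (x + s *: v) - F (x + s *: w) + F x =
    phi s - phi 0.
  by rewrite /phi scale0r addr0 opprB addrA addrAC.
rewrite Er; move: Ec; rewrite scale0r addr0 => ->.
rewrite !subr0 -(mulrA _ s s) mulfK ?mulf_neq0 ?gt_eqF//.
by have [] := dP r c rd (sI _ cs).
Qed.

(** The second difference is symmetric in [v] and [w], so for small [s] both mixed derivatives lie
    within e/2 of the same quotient. *)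
Lemma schwarz F (U : set V) x v w : open U -> U x ->
  (forall z, U z -> derivable F z v) -> (forall z, U z -> derivable F z w) ->
  (forall z, U z -> derivable ('D_v F) z w) ->
  (forall z, U z -> derivable ('D_w F) z v) ->
  {for x, continuous ('D_w ('D_v F))} -> {for x, continuous ('D_v ('D_w F))} ->
  'D_w ('D_v F) x = 'D_v ('D_w F) x.
Proof.
move=> oU Ux dv dw dvw dwv cvw cwv; apply/eqP; rewrite -subr_eq0 -normr_le0.
apply/ler_addgt0Pl => e e0; rewrite addr0.
have e2 : 0 < e / 2 by rewrite divr_gt0.
have [d1 d10 H1] := second_difference oU Ux dv dvw cvw e2.
have [d2 d20 H2] := second_difference oU Ux dw dwv cwv e2.
pose s := Num.min d1 d2 / 2.
have m0 : 0 < Num.min d1 d2 by rewrite lt_min d10.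
have s0 : 0 < s by rewrite divr_gt0.
have sm : s < Num.min d1 d2 by rewrite /s; lra.
have := H1 s; have := H2 s; move: sm; rewrite lt_min => /andP[-> ->].
rewrite s0 => /(_ isT) h2 /(_ isT) h1.
have E : F (x + s *: w + s *: v) - F (x + s *: w) - F (x + s *: v) =
    F (x + s *: v + s *: w) - F (x + s *: v) - F (x + s *: w).
  by rewrite addrAC (addrAC x).
rewrite E in h2; move: h1 h2; set q := _ / _ => h1 h2.
apply: le_trans (ler_distD q _ _) _; rewrite distrC [leRHS](splitr e).
by apply: lerD; [exact: ltW h1 | exact: ltW h2].
Qed.

End Schwarz.

(** * Smooth functions and their jets *)

Section SmoothFunctions.
Variables (R : realType) (V : normedModType R).
Implicit Types (F G : V -> R) (U : set V).

Lemma near_open U (P : V -> Prop) x : open U -> U x ->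
  (forall z, U z -> P z) -> \forall z \near x, P z.
Proof.
by move=> oU Ux UP; apply: filterS (open_nbhs_nbhs (conj oU Ux)) => z /UP.
Qed.

Lemma eq_open_derivable U F G x v : open U -> U x ->
  (forall z, U z -> F z = G z) -> derivable F x v -> derivable G x v.
Proof.
move=> oU Ux FG; apply: near_eq_derivable; exact: near_open FG.
Qed.

Lemma eq_open_derive U F G x v : open U -> U x ->
  (forall z, U z -> F z = G z) -> 'D_v F x = 'D_v G x.
Proof. by move=> oU Ux FG; apply: near_eq_derive; exact: near_open FG. Qed.

Lemma eq_open_continuous U F G x : open U -> U x ->
  (forall z, U z -> F z = G z) -> {for x, continuous F} ->
  {for x, continuous G}.
Proof.
move=> oU Ux FG Fx; rewrite /prop_for /continuous_at -(FG _ Ux).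
by apply: cvg_trans Fx; apply: near_eq_cvg; apply: near_open FG.
Qed.

Lemma eq_open_Ck k U F G : open U -> (forall z, U z -> F z = G z) ->
  Ck k U F -> Ck k U G.
Proof.
move=> oU; elim: k F G => [|k IH] F G FG /= [cF dF]; split=> //.
- by move=> x Ux; apply: (eq_open_continuous oU Ux FG); exact: cF.
- by move=> x Ux; apply: (eq_open_continuous oU Ux FG); exact: cF.
- move=> v; have [{}dF kF] := dF v; split=> [x Ux|].
    by apply: (eq_open_derivable oU Ux FG); exact: dF.
  by apply: IH kF => x Ux; exact: (eq_open_derive _ oU Ux FG).
Qed.

Lemma sub_Ck k U U' F : U' `<=` U -> Ck k U F -> Ck k U' F.
Proof.
move=> U'U; elim: k F => [|k IH] F /= [cF dF]; split=> //.
- by move=> x /U'U; exact: cF.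
- by move=> x /U'U; exact: cF.
- move=> v; have [{}dF kF] := dF v; split; last exact: IH.
  by move=> x /U'U; exact: dF.
Qed.

Lemma local_Ck k U F :
  (forall x, U x -> exists U', [/\ open U', U' x & Ck k U' F]) -> Ck k U F.
Proof.
elim: k F => [|k IH] F H /=; split=> //.
- by move=> x /H[U' [_ U'x [+ _]]]; exact.
- by move=> x /H[U' [_ U'x [+ _]]]; exact.
- move=> v; split=> [x /H[U' [_ U'x [_ /(_ v)[+ _]]]]|]; first exact.
  by apply: IH => x /H[U' [oU' U'x [_ /(_ v)[_ kF]]]]; exists U'.
Qed.

Definition smooth U F := forall k, Ck k U F.

(** Around a point of the open set [U] the local extension agrees with [F] on a whole neighbourhood,
    and being C^k is a local property. *)
Lemma smooth_on_open U A F : open U -> U `<=` A -> smooth_on A F -> smooth U F.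
Proof.
move=> oU UA sF k; apply: local_Ck => x Ux.
have [U' [G [oU' U'x kG GF]]] := sF x (UA _ Ux).
have oI := openI oU' oU; exists (U' `&` U); split=> //.
apply: (eq_open_Ck oI (F := G)); last exact: sub_Ck (kG k).
move=> z [U'z Uz]; apply: GF; rewrite inE; split=> //; exact: UA.
Qed.

Lemma smooth_continuous U F x : smooth U F -> U x -> {for x, continuous F}.
Proof. by move=> /(_ 0%N)[+ _]; apply. Qed.

Lemma smooth_derivable U F x v : smooth U F -> U x -> derivable F x v.
Proof. by move=> /(_ 1%N)[_ /(_ v)[+ _]]; apply. Qed.

Lemma smooth_derive U F v : smooth U F -> smooth U ('D_v F).
Proof. by move=> sF k; have [_ /(_ v)[_]] := sF k.+1. Qed.

Lemma smooth_schwarz U F x v w : open U -> U x -> smooth U F ->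
  'D_w ('D_v F) x = 'D_v ('D_w F) x.
Proof.
move=> oU Ux sF; have [sv sw] := (smooth_derive v sF, smooth_derive w sF).
apply: (schwarz oU Ux) => [z Uz|z Uz|z Uz|z Uz||].
- exact: smooth_derivable sF Uz.
- exact: smooth_derivable sF Uz.
- exact: smooth_derivable sv Uz.
- exact: smooth_derivable sw Uz.
- exact: smooth_continuous (smooth_derive w sv) Ux.
- exact: smooth_continuous (smooth_derive v sw) Ux.
Qed.

Lemma smooth_iter_derive U F v n : smooth U F ->
  smooth U (iter n (fun G => 'D_v G) F).
Proof. by move=> sF; elim: n => //= n; exact: smooth_derive. Qed.

Lemma derive_iter_comm U F x v w n : open U -> U x -> smooth U F ->
  'D_w (iter n (fun G => 'D_v G) F) x = iter n (fun G => 'D_v G) ('D_w F) x.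
Proof.
move=> oU + sF; elim: n x => //= n IH x Ux.
rewrite (smooth_schwarz v w oU Ux (smooth_iter_derive v n sF)).
by apply: eq_open_derive oU Ux _ => z Uz; exact: IH.
Qed.

End SmoothFunctions.

(** * Partial derivatives in space-time and the chain rule *)

Inductive axis := T0 | X1 | X2.

Section Jets.
Variable R : realType.
Notation V := (R * 'rV[R]_2)%type.
Implicit Types (F G : V -> R) (U : set V) (z : V).

Definition axis_vec (i : axis) : V := match i with
  T0 => (1, 0) | X1 => (0, delta_mx 0 0) | X2 => (0, delta_mx 0 1) end.

(* [J p q r] stands for the derivative of order [p] in time and of orders [q]
   and [r] along the two coordinate axes of the plane. *)
Definition jet_family U (J : nat -> nat -> nat -> V -> R) :=
  forall p q r z, U z -> [/\ {for z, continuous (J p q r)},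
    is_derive z (axis_vec T0) (J p q r) (J p.+1 q r z),
    is_derive z (axis_vec X1) (J p q r) (J p q.+1 r z) &
    is_derive z (axis_vec X2) (J p q r) (J p q r.+1 z)].

Lemma smooth_jets U F : open U -> smooth U F ->
  exists2 J, jet_family U J & J 0%N 0%N 0%N = F.
Proof.
move=> oU sF.
pose D i n (G : V -> R) := iter n (fun G : V -> R => 'D_(axis_vec i) G) G.
have sD i n G : smooth U G -> smooth U (D i n G) by exact: smooth_iter_derive.
have cD i j n G x : smooth U G -> U x ->
    'D_(axis_vec i) (D j n G) x = D j n ('D_(axis_vec i) G) x.
  by move=> sG Ux; exact: (derive_iter_comm _ _ _ oU Ux sG).
have eqD i n G G' : (forall y, U y -> G y = G' y) ->
    forall y, U y -> D i n G y = D i n G' y.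
  move=> GG'; elim: n => [|n IH] y Uy; first exact: GG'.
  exact: eq_open_derive oU Uy IH.
(* With the derivatives in this fixed order, a further one along [X1] or [X2] has to be commuted
   inwards to its place. *)
exists (fun p q r => D T0 p (D X1 q (D X2 r F))) => // p q r z Uz.
have s2 := sD X2 r _ sF; have s1 := sD X1 q _ s2; have s0 := sD T0 p _ s1.
split; first exact: smooth_continuous s0 Uz.
- by apply: derivableP; exact: smooth_derivable s0 Uz.
- apply: DeriveDef; first exact: smooth_derivable s0 Uz.
  exact: cD.
- apply: DeriveDef; first exact: smooth_derivable s0 Uz.
  rewrite cD//; apply: eqD Uz => y Uy; exact: cD.
Qed.

(** A chain rule from continuous partial derivatives alone: the mean value theorem along one axis
    and then along the other bounds the first-order error by e times the sum of the two increments.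
    It serves the change of chart. *)
Lemma jet_derive_curve U J (c1 c2 : R -> R) (t m1 m2 : R) (x : 'rV[R]_2) p q r :
  open U -> jet_family U J -> U (t, x) ->
  c1 0 = 0 -> c2 0 = 0 -> is_derive (0 : R) 1 c1 m1 -> is_derive (0 : R) 1 c2 m2 ->
  is_derive (0 : R) 1
    (fun s => J p q r (t, x + (c1 s *: delta_mx 0 0 + c2 s *: delta_mx 0 1)))
    (m1 * J p q.+1 r (t, x) + m2 * J p q r.+1 (t, x)).
Proof.
move=> oU UJ Ux c10 c20 dc1 dc2.
set F := J p q r; set F1 := J p q.+1 r; set F2 := J p q r.+1.
pose e1 : V := axis_vec X1; pose e2 : V := axis_vec X2.
have est (e : R) : 0 < e -> exists2 d : R, 0 < d &
    forall a b : R, `|a| < d -> `|b| < d ->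
    `|F ((t, x) + a *: e1 + b *: e2) - F (t, x) - (a * F1 (t, x) + b * F2 (t, x))|
      <= e * (`|a| + `|b|).
  move=> e0.
  have [c1x _ _ _] := UJ p q.+1 r _ Ux; have [c2x _ _ _] := UJ p q r.+1 _ Ux.
  have [d d0 dP] := @near_plane _ _ _ _ e1 e2 (filterI (open_nbhs_nbhs (conj oU Ux))
    (filterI (continuous_near c1x e0) (continuous_near c2x e0))).
  have d0' : `|0 : R| < d by rewrite normr0.
  exists d => // a b ad bd.
  have [|r1 r1a E1] := @mean_value R (fun a => F ((t, x) + a *: e1))
     (fun a => F1 ((t, x) + a *: e1)) 0 a.
    move=> r1; rewrite !subr0 => r1a; apply: is_derive_line.
    have [+ _] := dP r1 0 (le_lt_trans r1a ad) d0'.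
    by rewrite scale0r addr0 => /(UJ p q r)[].
  have [|r2 r2b E2] := @mean_value R (fun b => F ((t, x) + a *: e1 + b *: e2))
     (fun b => F2 ((t, x) + a *: e1 + b *: e2)) 0 b.
    move=> r2; rewrite !subr0 => r2b; apply: is_derive_line.
    have [+ _] := dP a r2 ad (le_lt_trans r2b bd).
    by move=> /(UJ p q r)[].
  rewrite !subr0 !scale0r !addr0 in r1a r2b E1 E2.
  have [_ [+ _]] := dP r1 0 (le_lt_trans r1a ad) d0'.
  have [_ [_ +]] := dP a r2 ad (le_lt_trans r2b bd).
  rewrite scale0r addr0 -/F1 -/F2.
  move: E1 E2; set A := F _; set B := F _; set C := F (_ + _ + _).
  set f1 := F1 _; set f2 := F2 _; set g1 := F1 _; set g2 := F2 _.
  move=> E1 E2 h2 h1.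
  have -> : C - B - (a * g1 + b * g2) = (f1 - g1) * a + (f2 - g2) * b by lra.
  apply: le_trans (ler_normD _ _) _; rewrite !normrM mulrDr.
  by apply: lerD; apply: ler_wpM2r => //; apply: ltW.

have quot (c : R -> R) m : c 0 = 0 -> is_derive (0 : R) 1 c m ->
    (h^-1 * c h) @[h --> (0 : R)^'] --> m.
  move=> c0 [dc <-]; apply: cvg_trans dc; apply: near_eq_cvg; near=> h.
  by rewrite /= [h *: 1]mulr1 addr0 c0 subr0.
have small (c : R -> R) (m d : R) : c 0 = 0 -> is_derive (0 : R) 1 c m -> 0 < d ->
    \forall h \near (0 : R)^', `|c h| < d.
  move=> c0 [/derivable1_diffP/differentiable_continuous cc _] d0.
  apply: nbhs_dnbhs; have := continuous_near cc d0; rewrite c0.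
  by apply: filterS => h; rewrite subr0.
have [q1 q2] := (quot _ _ c10 dc1, quot _ _ c20 dc2).
pose psi s := F (t, x + (c1 s *: delta_mx 0 0 + c2 s *: delta_mx 0 1)).
have psiE s : psi s = F ((t, x) + c1 s *: e1 + c2 s *: e2).
  rewrite /psi; congr F; rewrite /e1 /e2 /axis_vec.
  by congr pair; rewrite /= ?scaler0 ?addr0// addrA.
have psi0 : psi 0 = F (t, x) by rewrite psiE c10 c20 !scale0r !addr0.
suff lim0 : (h^-1 * (psi h - psi 0)) @[h --> (0 : R)^'] -->
    m1 * F1 (t, x) + m2 * F2 (t, x).
  have E : (fun h : R => h^-1 *: ((psi \o shift 0) (h *: 1) - psi 0)) =
      (fun h => h^-1 * (psi h - psi 0)).
    by apply/funext => h /=; rewrite [h *: 1]mulr1 addr0.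
  split; first by rewrite /derivable E; apply/cvg_ex; exists (m1 * F1 (t, x) + m2 * F2 (t, x)).
  by rewrite /derive E; exact: cvg_lim lim0.
have lin : (h^-1 * c1 h * F1 (t, x) + h^-1 * c2 h * F2 (t, x)) @[h --> (0 : R)^']
    --> m1 * F1 (t, x) + m2 * F2 (t, x).
  by apply: cvgD; apply: cvgMr_tmp.
rewrite -[X in _ --> X]addr0.
pose err h := h^-1 * (psi h - psi 0) -
  (h^-1 * c1 h * F1 (t, x) + h^-1 * c2 h * F2 (t, x)).
suff err0 : err h @[h --> (0 : R)^'] --> (0 : R).
  by apply: cvg_trans (cvgD lin err0); apply: near_eq_cvg; near=> h; rewrite /err /= addrC subrK.
apply/cvgr0Pnorm_le => e e0.
(* For small h the quotients of [c1] and [c2] are within 1 of [m1] and [m2], so the two increments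
   add up to at most N |h|; hence the tolerance e / N. *)
pose N := `|m1| + `|m2| + 2.
have N0 : 0 < N by rewrite ltr_wpDl// addr_ge0.
have [d d0 dP] := est (e / N) (divr_gt0 e0 N0).
have [s1 s2] := (small _ _ _ c10 dc1 d0, small _ _ _ c20 dc2 d0).
move/cvgrPdist_lt : q1 => /(_ 1 ltr01) q1.
move/cvgrPdist_lt : q2 => /(_ 1 ltr01) q2.
near=> h.
have h0 : h != 0 by near: h; exact: nbhs_dnbhs_neq.
have ad : `|c1 h| < d by near: h.
have bd : `|c2 h| < d by near: h.
have n1 : `|m1 - h^-1 * c1 h| < 1 by near: h.
have n2 : `|m2 - h^-1 * c2 h| < 1 by near: h.
have -> : err h = h^-1 * (psi h - F (t, x) - (c1 h * F1 (t, x) + c2 h * F2 (t, x))).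
  by rewrite /err psi0; ring.
rewrite normrM psiE; apply: le_trans (ler_wpM2l (normr_ge0 _) (dP _ _ ad bd)) _.
have b1 : `|h^-1| * `|c1 h| <= `|m1| + 1.
  rewrite -normrM; move: (ler_distD 0 (h^-1 * c1 h) m1) => _.
  have := lerB_dist (h^-1 * c1 h) m1; rewrite distrC; lra.
have b2 : `|h^-1| * `|c2 h| <= `|m2| + 1.
  rewrite -normrM; have := lerB_dist (h^-1 * c2 h) m2; rewrite distrC; lra.
rewrite mulrCA mulrDr mulrAC ler_pdivrMr// ler_pM2l//.
by rewrite /N; lra.
Unshelve. all: by end_near.
Qed.

End Jets.

(** * Differential expressions *)

(* Formal expressions in the jets of finitely many functions of space-time
   ([Jet n p q r] is the derivative of order (p, q, r) of the n-th one). The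
   derivations [der] act on them, so that an identity between differential
   expressions becomes, after evaluation, a field identity between jets. *)
Inductive expr (R : Type) :=
  | Cst of R | Jet of nat & nat & nat & nat
  | Add of expr R & expr R | Mul of expr R & expr R | Opp of expr R
  | Inv of expr R | Ln of expr R.
Arguments Jet {R}.

Declare Scope expr_scope.
Delimit Scope expr_scope with X.
Bind Scope expr_scope with expr.
Notation "x + y" := (Add x y) : expr_scope.
Notation "x * y" := (Mul x y) : expr_scope.
Notation "- x" := (Opp x) : expr_scope.
Notation "x - y" := (Add x (Opp y)) : expr_scope.
Notation "x / y" := (Mul x (Inv y)) : expr_scope.

Section Expressions.
Variable R : realType.
Implicit Types (e u : expr R) (i j : axis).

Fixpoint der i e : expr R := match e with
  | Cst _ => Cst 0
  | Jet n p q r => match i with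
      T0 => Jet n p.+1 q r | X1 => Jet n p q.+1 r | X2 => Jet n p q r.+1 end
  | Add e1 e2 => der i e1 + der i e2
  | Mul e1 e2 => der i e1 * e2 + e1 * der i e2
  | Opp e1 => - der i e1
  | Inv e1 => - (der i e1 * (Inv e1 * Inv e1))
  | Ln e1 => der i e1 / e1
  end%X.

Fixpoint eval (J : nat -> nat -> nat -> nat -> R) e : R := match e with
  | Cst c => c
  | Jet n p q r => J n p q r
  | Add e1 e2 => eval J e1 + eval J e2
  | Mul e1 e2 => eval J e1 * eval J e2
  | Opp e1 => - eval J e1
  | Inv e1 => (eval J e1)^-1
  | Ln e1 => ln (eval J e1)
  end.

Fixpoint defined (J : nat -> nat -> nat -> nat -> R) e : Prop := match e with
  | Cst _ | Jet _ _ _ _ => True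
  | Add e1 e2 | Mul e1 e2 => defined J e1 /\ defined J e2
  | Opp e1 => defined J e1
  | Inv e1 => defined J e1 /\ eval J e1 != 0
  | Ln e1 => defined J e1 /\ 0 < eval J e1
  end.

Lemma defined_der J i e : defined J e -> defined J (der i e).
Proof.
elim: e => [c|n p q r|e1 IH1 e2 IH2|e1 IH1 e2 IH2|e1 IH1|e1 IH1|e1 IH1] //=.
- by case: i.
- by move=> [/IH1 ? /IH2 ?].
- by move=> [? ?]; split; split=> //; [exact: IH1 | exact: IH2].
- by move=> [d1 n1]; split=> //; exact: IH1.
- by move=> [d1 p1]; rewrite (gt_eqF p1); split=> //; exact: IH1.
Qed.

(** For jets the symmetry is built into the indexing by orders; the other constructors inherit it by
    algebra. *)
Lemma der_comm J i j e : defined J e ->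
  eval J (der i (der j e)) = eval J (der j (der i e)).
Proof.
elim: e => [c|n p q r|e1 IH1 e2 IH2|e1 IH1 e2 IH2|e1 IH1|e1 IH1|e1 IH1] //=.
- by case: i; case: j.
- by move=> [/IH1 -> /IH2 ->].
- by move=> [/IH1 -> /IH2 ->]; ring.
- by move=> /IH1 ->.
- by move=> [/IH1 -> _]; ring.
- by move=> [/IH1 -> _]; ring.
Qed.

Section Evaluation.
Variables (U : set (R * 'rV[R]_2)) (J : nat -> nat -> nat -> nat -> R * 'rV[R]_2 -> R).
Hypotheses (oU : open U) (HJ : forall n, jet_family U (J n)).

Definition jets_at z n p q r := J n p q r z.
Definition val e z := eval (jets_at z) e.
Definition defined_on e := forall z, U z -> defined (jets_at z) e.

Lemma val_derive e i z : defined_on e -> U z ->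
  {for z, continuous (val e)} /\
  is_derive z (axis_vec R i) (val e) (val (der i e) z).
Proof.
move=> + Uz; elim: e => [c|n p q r|e1 IH1 e2 IH2|e1 IH1 e2 IH2|e1 IH1|e1 IH1|e1 IH1] De.
- split; first exact: cvg_cst.
  exact: is_derive_cst.
- by have [cJ] := HJ n p q r Uz; case: i.
- have [c1 d1] := IH1 (fun z Uz => (De z Uz).1).
  have [c2 d2] := IH2 (fun z Uz => (De z Uz).2).
  split; first exact: continuousD c1 c2.
  exact: is_deriveD d1 d2.
- have [c1 d1] := IH1 (fun z Uz => (De z Uz).1).
  have [c2 d2] := IH2 (fun z Uz => (De z Uz).2).
  split; first exact: continuousM c1 c2.
  by apply: is_derive_eq (is_deriveM d1 d2) _; rewrite /= /val /= /GRing.scale /=; ring.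
- have [c1 d1] := IH1 De; split; first exact: continuousN c1.
  exact: is_deriveN d1.
- have [c1 d1] := IH1 (fun z Uz => (De z Uz).1).
  have n1 : val e1 z != 0 := (De z Uz).2.
  split; first exact: cvgV n1 c1.
  case: d1 => d1 E1; split; first exact: derivableV n1 d1.
  have E := deriveV n1 d1.
  rewrite [LHS]E E1 /val /= /GRing.scale /= -exprVn; ring.
- have [c1 d1] := IH1 (fun z Uz => (De z Uz).1).
  have p1 : 0 < val e1 z := (De z Uz).2.
  split; first exact: continuous_comp c1 (continuous_ln p1).
  apply: is_derive_of_line.
  have p1' : 0 < val e1 (z + (0 : R) *: axis_vec R i) by rewrite scale0r addr0.
  have dl : is_derive (0 : R) 1 (fun r => val e1 (z + r *: axis_vec R i))
      (val (der i e1) z).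
    by apply: is_derive_line; rewrite scale0r addr0.
  apply: is_derive_eq (is_derive1_comp (is_derive1_ln p1') dl) _.
  by rewrite scale0r addr0 /val /= /GRing.scale /= mulrC.
Qed.

Lemma defined_on_der e i : defined_on e -> defined_on (der i e).
Proof. by move=> De z /De; exact: defined_der. Qed.

(** An equation between expressions may be differentiated when it holds on all of the open set [U].
    This is why the equations for w, K and R are assumed throughout [U] and not just at the
    minimum. *)
Lemma val_der_eq e u i z : defined_on e -> defined_on u ->
  (forall y, U y -> val e y = val u y) -> U z ->
  val (der i e) z = val (der i u) z.
Proof.
move=> De Du eu Uz; have [_ [_ <-]] := val_derive i De Uz.
have [_ [_ <-]] := val_derive i Du Uz.
exact: eq_open_derive oU Uz eu.
Qed.

Definition expr_jets e p q r :=
  val (iter p (der T0) (iter q (der X1) (iter r (der X2) e))).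

Lemma defined_on_iter e i n : defined_on e -> defined_on (iter n (der i) e).
Proof. by move=> De; elim: n => //= n; exact: defined_on_der. Qed.

Lemma val_iter_comm e i j n z : defined_on e -> U z ->
  val (der i (iter n (der j) e)) z = val (iter n (der j) (der i e)) z.
Proof.
move=> De; elim: n z => //= n IH z Uz.
rewrite {1}/val der_comm; last exact: defined_on_iter Uz.
apply: val_der_eq Uz => //; first exact/defined_on_der/defined_on_iter.
by apply/defined_on_iter/defined_on_der.
Qed.

(** Allows an expression such as the scalar curvature, ln f or K to be adjoined as a new function
    with its own jets, which keeps later formulas small. *)
Lemma expr_jet_family e : defined_on e -> jet_family U (expr_jets e).
Proof.
move=> De p q r z Uz.
have D2 := defined_on_iter X2 r De; have D1 := defined_on_iter X1 q D2.
have D0 := defined_on_iter T0 p D1.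
have [c0 d0] := val_derive T0 D0 Uz.
split=> //.
- have [_ d1] := val_derive X1 D0 Uz.
  by apply: is_derive_eq d1 _; rewrite val_iter_comm.
- have [_ d2] := val_derive X2 D0 Uz.
  apply: is_derive_eq d2 _; rewrite val_iter_comm// /expr_jets.
  have : forall y, U y -> val (der X2 (iter q (der X1) (iter r (der X2) e))) y =
      val (iter q (der X1) (iter r.+1 (der X2) e)) y.
    by move=> y Uy; rewrite val_iter_comm.
  have := defined_on_der X2 D1.
  have := defined_on_iter X1 q (defined_on_iter X2 r.+1 De).
  move: (der X2 (iter q _ _)) (iter q _ (iter r.+1 _ _)) => u u' Du' Du uu'.
  elim: p {D0 c0 d0} z Uz => [|p IH] z Uz /=; first exact: uu'.
  by apply: val_der_eq Uz => //; exact: defined_on_iter.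
Qed.

End Evaluation.
End Expressions.

(** * Evolution equations in a chart *)

(** Turns each jet into an independent variable, so that a differential identity becomes a rational
    identity for [field]. *)
Ltac generalize_jets := repeat match goal with
  |- context [?J ?n ?p ?q ?r] => lazymatch type of J with
    nat -> nat -> nat -> nat -> _ => generalize (J n p q r) => ? end end.

Section Curvature.
Variable R : realType.
Implicit Types (u v : expr R) (J : nat -> nat -> nat -> nat -> R).
Local Open Scope expr_scope.

(* Functions 0, 1 and 2 are the components of the metric, 4 is its scalar
   curvature, and 3 and 5 are [w] and [k = al * lap w + eps * s]. *)
Notation g11 := (@Jet R 0 0 0 0).
Notation g12 := (@Jet R 1 0 0 0).
Notation g22 := (@Jet R 2 0 0 0).
Notation w := (@Jet R 3 0 0 0).
Notation s := (@Jet R 4 0 0 0).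
Notation k := (@Jet R 5 0 0 0).

Definition detE : expr R := g11 * g22 - g12 * g12.

(** The divergence form d^(-1/2) D_i (d^(1/2) g^ij D_j u), where d is the determinant of the metric,
    expanded so that no square root remains. *)
Definition lapE u : expr R :=
  (g22 * der X1 (der X1 u) - Cst 2 * g12 * der X1 (der X2 u)
   + g11 * der X2 (der X2 u)
   + (der X1 g22 - der X2 g12) * der X1 u
   + (der X2 g11 - der X1 g12) * der X2 u) / detE
  - (der X1 detE * (g22 * der X1 u - g12 * der X2 u)
     + der X2 detE * (g11 * der X2 u - g12 * der X1 u))
    * Cst 2^-1 / (detE * detE).

Definition gradE u v : expr R :=
  (g22 * der X1 u * der X1 v
   - g12 * (der X1 u * der X2 v + der X2 u * der X1 v)
   + g11 * der X2 u * der X2 v) / detE.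

Definition metricE i j : expr R := match i, j with
  X1, X1 => g11 | X2, X2 => g22 | _, _ => g12 end.

Definition hessE i j u : expr R :=
  let b l := der i (metricE j l) + der j (metricE i l) - der l (metricE i j) in
  der i (der j u) - Cst 2^-1 / detE *
    ((g22 * b X1 - g12 * b X2) * der X1 u + (g11 * b X2 - g12 * b X1) * der X2 u).

(* Brioschi's formula for twice the Gauss curvature. *)
Definition scalE : expr R :=
  let h := Cst 2^-1 in
  let a1 := h * der X1 g11 in let a2 := h * der X2 g11 in
  let c1 := h * der X1 g22 in let c2 := h * der X2 g22 in
  let b1 := der X1 g12 in let b2 := der X2 g12 in
  let m := (- h) * der X2 (der X2 g11) + der X1 (der X2 g12)
           - h * der X1 (der X1 g22) in
  Cst 2 * (m * detE - a1 * ((b2 - c1) * g22 - g12 * c2)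
    + (b1 - a2) * ((b2 - c1) * g12 - g11 * c2)
    + a2 * (a2 * g22 - g12 * c1) - c1 * (a2 * g12 - g11 * c1))
  / (detE * detE).

Local Open Scope ring_scope.

(* The space derivatives of the equation [g_t = - eps s g]. *)
Definition conformal_jets (eps : R) J := forall n p q, (n < 3)%N ->
  J n 1%N p q = eval J (iter p (der X1) (iter q (der X2)
    (Cst (- eps)%R * s * Jet n 0 0 0)%X)).

(** In dimension 2 the Laplacian scales by the inverse of the conformal factor, and this factor
    changes at the relative rate - eps s. *)
Lemma lap_evolution eps J : eval J detE != 0 -> conformal_jets eps J ->
  eval J (der T0 (lapE w)) =
  eval J (lapE (der T0 w)) + eps * eval J s * eval J (lapE w).
Proof.
move=> + H; have [H0 [H1 H2]] := (fun p q => H 0%N p q isT,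
  (fun p q => H 1%N p q isT, fun p q => H 2%N p q isT)).
rewrite /= ?(H0, H1, H2) /=; generalize_jets => *.
by field.
Qed.

(** Here [s] is only the speed of the conformal change, not yet the curvature: this is the variation
    of R under g_t = - eps s g. Setting [s] equal to the curvature gives the reaction term R^2 in
    [scal_eq]. *)
Lemma scal_evolution eps J : eval J detE != 0 -> conformal_jets eps J ->
  eval J (der T0 scalE) = eps * (eval J (lapE s) + eval J s * eval J scalE).
Proof.
move=> + H; have [H0 [H1 H2]] := (fun p q => H 0%N p q isT,
  (fun p q => H 1%N p q isT, fun p q => H 2%N p q isT)).
rewrite /= ?(H0, H1, H2) /=; generalize_jets => *.
by field.
Qed.

(** In dimension 2, Ric = (R/2) g, whence the factor of the curvature term. The last bracket is 2
    |Hess w|^2, by |A|^2 = (tr A)^2 - 2 det A. *)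
Lemma bochner J : eval J detE != 0 ->
  eval J (lapE (gradE w w)) =
  2 * eval J (gradE w (lapE w)) + eval J scalE * eval J (gradE w w)
  + (2 * eval J (lapE w) ^+ 2
     - 4 * (eval J (hessE X1 X1 w) * eval J (hessE X2 X2 w)
            - eval J (hessE X1 X2 w) ^+ 2) / eval J detE).
Proof. by rewrite /=; generalize_jets => *; field. Qed.

Lemma lap_trace J u : eval J detE != 0 ->
  eval J (lapE u) = (eval J g22 * eval J (hessE X1 X1 u)
    - 2 * eval J g12 * eval J (hessE X1 X2 u)
    + eval J g11 * eval J (hessE X2 X2 u)) / eval J detE.
Proof.
by rewrite /=; generalize_jets; do !move: (eval J _) => ?; move=> *; field.
Qed.

(* The arithmetic-geometric mean inequality for the eigenvalues of the Hessian. *)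
Lemma lap_sqr_ge J u : 0 < eval J g11 -> 0 < eval J detE ->
  4 * (eval J (hessE X1 X1 u) * eval J (hessE X2 X2 u)
       - eval J (hessE X1 X2 u) ^+ 2) / eval J detE <= eval J (lapE u) ^+ 2.
Proof.
move=> a0 d0; rewrite (lap_trace _ (lt0r_neq0 d0)).
have : eval J detE = eval J g11 * eval J g22 - eval J g12 ^+ 2 by rewrite /= expr2.
move: a0 d0; generalize (eval J g11) (eval J g12) (eval J g22) (eval J detE).
move: (eval J (hessE X1 X1 u)) (eval J (hessE X1 X2 u)) (eval J (hessE X2 X2 u)).
move=> S11 S12 S22 a b c d a0 d0 dE.
have -> : c = (d + b ^+ 2) / a by rewrite dE; field; rewrite gt_eqF.
rewrite -subr_ge0.
(* The difference is the squared gap of the two eigenvalues. In the orthonormal frame obtained by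
   Gram-Schmidt from the coordinate axes it is (S22 - S11)^2 + 4 S12^2, and these are the two
   squares. *)
rewrite (_ : _ - _ = ((a * S22 - 2 * b * S12 + (b ^+ 2 - d) / a * S11) / d) ^+ 2
  + 4 / d * ((a * S12 - b * S11) / a) ^+ 2); last first.
  by field; rewrite !gt_eqF.
by rewrite addr_ge0 ?sqr_ge0// mulr_ge0 ?sqr_ge0// divr_ge0// ltW.
Qed.

(** The squared norm of the covector with components [x] and [y]. *)
Definition gram J (x y : R) : R :=
  (eval J g22 * x ^+ 2 - 2 * eval J g12 * x * y + eval J g11 * y ^+ 2) / eval J detE.

Lemma gram_ge0 J x y : 0 < eval J g11 -> 0 < eval J detE -> 0 <= gram J x y.
Proof.
move=> a0 d0; have : eval J detE = eval J g11 * eval J g22 - eval J g12 ^+ 2.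
  by rewrite /= expr2.
rewrite /gram; move: a0 d0.
generalize (eval J g11) (eval J g12) (eval J g22) (eval J detE) => a b c d.
move=> a0 d0 dE; have -> : c = (d + b ^+ 2) / a by rewrite dE; field; rewrite gt_eqF.
rewrite (_ : _ / d = ((a * y - b * x) ^+ 2 / d + x ^+ 2) / a); last first.
  by field; rewrite !gt_eqF.
by apply: divr_ge0 (ltW a0); rewrite addr_ge0 ?sqr_ge0// divr_ge0 ?sqr_ge0 ?ltW.
Qed.

Lemma lap_ge0 J u : 0 < eval J g11 -> 0 < eval J detE ->
  eval J (der X1 u) = 0 -> eval J (der X2 u) = 0 ->
  (forall x y : R, 0 <= x ^+ 2 * eval J (der X1 (der X1 u))
     + 2 * x * y * eval J (der X1 (der X2 u))
     + y ^+ 2 * eval J (der X2 (der X2 u))) ->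
  0 <= eval J (lapE u).
Proof.
move=> a0 d0 u1 u2 hess.
have -> : eval J (lapE u) = (eval J g22 * eval J (der X1 (der X1 u))
    - 2 * eval J g12 * eval J (der X1 (der X2 u))
    + eval J g11 * eval J (der X2 (der X2 u))) / eval J detE.
  by rewrite /= u1 u2; ring.
(* These two vectors are orthogonal for the metric, so the trace is a combination of the Hessian
   form on them with positive weights; at a critical point the first-order terms of the Laplacian
   are absent. *)
have := hess (- eval J g12) (eval J g11); have := hess 1 0.
have : eval J detE = eval J g11 * eval J g22 - eval J g12 ^+ 2 by rewrite /= expr2.
move: a0 d0; generalize (eval J g11) (eval J g12) (eval J g22) (eval J detE).
move: (eval J (der X1 (der X1 u))) (eval J (der X1 (der X2 u))).
move: (eval J (der X2 (der X2 u))) => S22 S11 S12 a b c d a0 d0 dE h1 h2.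
have -> : c = (d + b ^+ 2) / a by rewrite dE; field; rewrite gt_eqF.
rewrite (_ : _ / d = (((- b) ^+ 2 * S11 + 2 * (- b) * a * S12 + a ^+ 2 * S22)
  + d * (1 ^+ 2 * S11 + 2 * 1 * 0 * S12 + 0 ^+ 2 * S22)) / (a * d)); last first.
  by field; rewrite !gt_eqF.
by apply: divr_ge0; [rewrite addr_ge0// mulr_ge0// ltW | rewrite ltW// mulr_gt0].
Qed.

(** * The evolution of K and its time derivative at a spatial minimum *)

Section Evolution.
Variables (U : set (R * 'rV[R]_2)).
Variable J : nat -> nat -> nat -> nat -> R * 'rV[R]_2 -> R.
Hypotheses (oU : open U) (HJ : forall n, jet_family U (J n)).
Variables (eps al ga : R).
Hypotheses (al_ge0 : 0 <= al).
Hypothesis g11_gt0 : forall z, U z -> 0 < val J g11 z.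
Hypothesis det_gt0 : forall z, U z -> 0 < val J detE z.
Hypothesis flow : forall n z, (n < 3)%N -> U z ->
  J n 1%N 0%N 0%N z = - eps * val J s z * J n 0%N 0%N 0%N z.
Hypothesis scalJ : forall z, U z -> val J s z = val J scalE z.
Hypothesis wJ : forall z, U z -> val J (der T0 w) z =
  val J k z + al * val J (gradE w w) z + ga * val J w z.
Hypothesis kJ : forall z, U z ->
  val J k z = al * val J (lapE w) z + eps * val J s z.

Let det_neq0 z (Uz : U z) : val J detE z != 0.
Proof. exact: lt0r_neq0 (det_gt0 Uz). Qed.

Lemma defined_lapE u : defined_on U J u -> defined_on U J (lapE u).
Proof.
move=> Du z Uz; have dd := det_neq0 Uz; rewrite /val /= in dd; have dd2 := mulf_neq0 dd dd.
have d1 := defined_on_der X1 Du; have d2 := defined_on_der X2 Du.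
have d11 := defined_on_der X1 d1; have d12 := defined_on_der X1 d2.
have d22 := defined_on_der X2 d2.
by rewrite /=; repeat split => //; (exact: d1 || exact: d2 || exact: d11
  || exact: d12 || exact: d22).
Qed.

Lemma defined_gradE u v : defined_on U J u -> defined_on U J v ->
  defined_on U J (gradE u v).
Proof.
move=> Du Dv z Uz; have dd := det_neq0 Uz; rewrite /val /= in dd; have dd2 := mulf_neq0 dd dd.
have u1 := defined_on_der X1 Du; have u2 := defined_on_der X2 Du.
have v1 := defined_on_der X1 Dv; have v2 := defined_on_der X2 Dv.
by rewrite /=; repeat split => //; (exact: u1 || exact: u2 || exact: v1
  || exact: v2).
Qed.

Lemma defined_scalE : defined_on U J scalE.
Proof.
by move=> z Uz; have dd := det_neq0 Uz; rewrite /val /= in dd;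
  have dd2 := mulf_neq0 dd dd; rewrite /=; repeat split.
Qed.

Lemma val_iter_eq e u i n z : defined_on U J e -> defined_on U J u ->
  (forall y, U y -> val J e y = val J u y) -> U z ->
  val J (iter n (der i) e) z = val J (iter n (der i) u) z.
Proof.
move=> De Du eu; elim: n z => [|n IH] z Uz; first exact: eu.
by apply: (val_der_eq oU HJ) Uz => //; exact: defined_on_iter.
Qed.

Lemma flow_conformal z : U z -> conformal_jets eps (jets_at J z).
Proof.
move=> Uz n p q n3.
pose e : expr R := Jet n 1 0 0; pose u := (Cst (- eps)%R * s * Jet n 0 0 0)%X.
have De : defined_on U J e by [].
have Du : defined_on U J u by [].
have eu y : U y -> val J e y = val J u y by move=> Uy; exact: flow.
have e2u2 y : U y -> val J (iter q (der X2) e) y = val J (iter q (der X2) u) y.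
  exact: val_iter_eq.
have := val_iter_eq X1 p (defined_on_iter X2 q De) (defined_on_iter X2 q Du) e2u2 Uz.
have -> // : iter p (der X1) (iter q (der X2) e) = Jet n 1 p q.
have -> : iter q (der X2) e = Jet n 1 0 q by elim: q {e2u2} => //= q ->.
by elim: p => //= p ->.
Qed.

Lemma lapE_eq e u z : defined_on U J e -> defined_on U J u ->
  (forall y, U y -> val J e y = val J u y) -> U z ->
  val J (lapE e) z = val J (lapE u) z.
Proof.
move=> De Du eu Uz.
have D i y : U y -> val J (der i e) y = val J (der i u) y.
  exact: (val_der_eq oU HJ i De Du eu).
have DD i j : val J (der j (der i e)) z = val J (der j (der i u)) z.
  by apply: (val_der_eq oU HJ j _ _ (D i) Uz); exact: defined_on_der.
move: (D X1 z Uz) (D X2 z Uz) (DD X1 X1) (DD X2 X1) (DD X2 X2).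
by rewrite /val /= => -> -> -> -> ->.
Qed.

Lemma gradE_eq v e u z : defined_on U J e -> defined_on U J u ->
  (forall y, U y -> val J e y = val J u y) -> U z ->
  val J (gradE v e) z = val J (gradE v u) z.
Proof.
move=> De Du eu Uz.
have D i : val J (der i e) z = val J (der i u) z.
  exact: (val_der_eq oU HJ i De Du eu Uz).
by move: (D X1) (D X2); rewrite /val /= => -> ->.
Qed.

Lemma scal_eq z : U z ->
  val J (der T0 s) z = eps * (val J (lapE s) z + val J s z ^+ 2).
Proof.
move=> Uz; rewrite (val_der_eq oU HJ T0 _ defined_scalE scalJ Uz)//.
rewrite /val (scal_evolution (det_neq0 Uz) (flow_conformal Uz)).
by have := scalJ Uz; rewrite /val => <-; rewrite expr2.
Qed.

(** Bochner's formula brings in 2 al^2 <dw, d Lap w>. Since al Lap w = K - eps s, it is regrouped as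
    2 al <dw, dK> - 2 al eps <dw, ds>, whose first part vanishes where dK = 0. *)
Lemma evolution z : U z -> val J (der T0 k) z =
  al * val J (lapE k) z + 2 * al * val J (gradE w k) z
  + al ^+ 2 * (val J s z * val J (gradE w w) z
     + (2 * val J (lapE w) z ^+ 2
        - 4 * (val J (hessE X1 X1 w) z * val J (hessE X2 X2 w) z
               - val J (hessE X1 X2 w) z ^+ 2) / val J detE z))
  - 2 * al * eps * val J (gradE w s) z
  + al * eps * val J s z * val J (lapE w) z + al * ga * val J (lapE w) z
  + eps ^+ 2 * (val J (lapE s) z + val J s z ^+ 2).
Proof.
move=> Uz; have Dl : defined_on U J (lapE w) by exact: defined_lapE.
have Dg : defined_on U J (gradE w w) by exact: defined_gradE.
pose kE := (Cst al * lapE w + Cst eps * s)%X.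
have DkE : defined_on U J kE by move=> y Uy; do 2!split=> //; exact: Dl.
pose wE := (k + Cst al * gradE w w + Cst ga * w)%X.
have DwE : defined_on U J wE by move=> y Uy; split; split=> //; split=> //; exact: Dg.
have Dk : defined_on U J k by [].
have Dw : defined_on U J (der T0 w) by [].
have E1 : val J (der T0 k) z = al * val J (der T0 (lapE w)) z + eps * val J (der T0 s) z.
  rewrite (val_der_eq oU HJ T0 Dk DkE kJ Uz).
  (* Only the linearity of the derivation counts here, so [lapE w] becomes an arbitrary
     expression. *)
  by rewrite /kE; move: (lapE w) => G; rewrite /val /=; ring.
have E2 : val J (lapE (der T0 w)) z = val J (lapE k) z
    + al * val J (lapE (gradE w w)) z + ga * val J (lapE w) z.
  rewrite (lapE_eq Dw DwE wJ Uz) /wE; move: (gradE w w) => G.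
  by rewrite /val /=; ring.
have E3 : val J (gradE w k) z = al * val J (gradE w (lapE w)) z + eps * val J (gradE w s) z.
  rewrite (gradE_eq w Dk DkE kJ Uz) /kE; move: (lapE w) => G.
  by rewrite /val /=; ring.
rewrite E1 scal_eq// {1}/val (lap_evolution (det_neq0 Uz) (flow_conformal Uz)).
rewrite -![eval _ _]/(val J _ z) E2 E3.
have := bochner (det_neq0 Uz); rewrite -![eval _ _]/(val J _ z) => ->.
by rewrite -(scalJ Uz); ring.
Qed.

Definition spatial_min (F : nat -> nat -> nat -> R) :=
  [/\ F 0%N 1%N 0%N = 0, F 0%N 0%N 1%N = 0 &
   forall x y : R, 0 <= x ^+ 2 * F 0%N 2%N 0%N + 2 * x * y * F 0%N 1%N 1%N
     + y ^+ 2 * F 0%N 0%N 2%N].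

Lemma evolution_at_min z : U z -> spatial_min (jets_at J z 5) ->
  al ^+ 2 * (val J (lapE w) z ^+ 2 + val J s z * val J (gradE w w) z)
  - 2 * al * eps * val J (gradE w s) z
  + al * eps * val J s z * val J (lapE w) z + al * ga * val J (lapE w) z
  + eps ^+ 2 * (val J (lapE s) z + val J s z ^+ 2) <= val J (der T0 k) z.
Proof.
move=> Uz [k1 k2 hess]; rewrite evolution//.
have [a0 d0] := (g11_gt0 Uz, det_gt0 Uz).
have lk : 0 <= al * val J (lapE k) z by rewrite mulr_ge0// lap_ge0.
have -> : val J (gradE w k) z = 0 by rewrite /val /= k1 k2; ring.
have := ler_wpM2l (sqr_ge0 al) (lap_sqr_ge w a0 d0).
rewrite -!/(val J _ z) => hw; move: lk hw.
move: (val _ _ _) (val _ _ _ * val _ _ _ - _) => *; lra.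
Qed.

Lemma lap_ln u z : 0 < val J u z -> U z ->
  val J (lapE (Ln u)) z = val J (lapE u) z / val J u z
    - val J (gradE u u) z / val J u z ^+ 2.
Proof.
move=> u0 Uz; have := det_neq0 Uz; have := lt0r_neq0 u0.
by rewrite /val /=; do !move: (eval _ _) => ?; generalize_jets => *; field; apply/andP.
Qed.

Lemma grad_ln u v z : 0 < val J v z -> U z ->
  val J (gradE u (Ln v)) z = val J (gradE u v) z / val J v z.
Proof.
move=> s0 Uz; have := det_neq0 Uz; have := lt0r_neq0 s0.
by rewrite /val /=; do !move: (eval _ _) => ?; generalize_jets => *; field; apply/andP.
Qed.

Lemma grad_sym u v z : val J (gradE u v) z = val J (gradE v u) z.
Proof. by rewrite /val /=; ring. Qed.

Lemma ln_scal_heat z : 0 < val J s z -> U z -> val J (der T0 (Ln s)) z =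
  eps * val J (lapE (Ln s)) z + eps * val J s z
  + eps * val J (gradE (Ln s) (Ln s)) z.
Proof.
move=> s0 Uz; have -> : val J (der T0 (Ln s)) z = val J (der T0 s) z / val J s z by [].
rewrite scal_eq// lap_ln// grad_ln// grad_sym grad_ln//.
by field; exact: lt0r_neq0.
Qed.

Lemma harnack_scal_at_min z : al = eps -> ga = 0 ->
  (forall y, U y -> 0 < val J s y) ->
  (forall y, U y -> val J w y = ln (val J s y)) -> U z ->
  spatial_min (jets_at J z 5) -> val J k z ^+ 2 <= val J (der T0 k) z.
Proof.
move=> ale ga0 s_gt0 ln_s Uz zmin; have s0 := s_gt0 _ Uz.
have Dln : defined_on U J (Ln s) by move=> y /s_gt0.
have lw : val J (lapE w) z = val J (lapE (Ln s)) z by exact: lapE_eq.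
have gw u : val J (gradE u w) z = val J (gradE u (Ln s)) z by exact: gradE_eq.
apply: le_trans (evolution_at_min Uz zmin); rewrite kJ// ale ga0.
rewrite [val J (gradE w s) z]grad_sym !gw [val J (gradE w _) z]grad_sym gw lw.
rewrite lap_ln// !grad_ln// grad_sym grad_ln//.
rewrite le_eqVlt; apply/orP; left; apply/eqP; field; exact: lt0r_neq0.
Qed.

Lemma harnack_heat_at_min z : 0 <= eps -> al = 1 -> ga = -1 ->
  0 < val J s z -> U z -> spatial_min (jets_at J z 5) ->
  val J k z <= 0 -> val J k z <= eps * (val J (lapE (Ln s)) z + val J s z) ->
  val J k z ^+ 2 <= val J (der T0 k) z.
Proof.
move=> eps0 al1 ga1 s0 Uz zmin k0 kQ.
apply: le_trans (evolution_at_min Uz zmin).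
move: kQ; rewrite lap_ln//; have := kJ Uz; rewrite al1 ga1.
have [a0 d0] := (g11_gt0 Uz, det_gt0 Uz).
have := gram_ge0 (val J s z * val J (der X1 w) z - eps * val J (der X1 s) z)
  (val J s z * val J (der X2 w) z - eps * val J (der X2 s) z) a0 d0.
have -> : gram (jets_at J z) (val J s z * val J (der X1 w) z - eps * val J (der X1 s) z)
    (val J s z * val J (der X2 w) z - eps * val J (der X2 s) z) =
  val J s z ^+ 2 * val J (gradE w w) z - 2 * eps * val J s z * val J (gradE w s) z
  + eps ^+ 2 * val J (gradE s s) z.
  by rewrite /gram /val /=; ring.
move: s0 k0; move: (val J (lapE w) z) (val J (lapE s) z) (val J (gradE w w) z)
 (val J (gradE w s) z) (val J (gradE s s) z) (val J s z) (val J k z).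
move=> L M A B C S K S0 K0 psd KE KQ.
have LE : L = K - eps * S by rewrite KE; ring.
rewrite -subr_ge0 (_ : _ - _ = (S ^+ 2 * A - 2 * eps * S * B + eps ^+ 2 * C) / S
  + eps * S * (eps * (M / S - C / S ^+ 2 + S) - K) + (- K) + eps * S); last first.
  by rewrite LE; field; exact: lt0r_neq0.
have eS : 0 <= eps * S by rewrite mulr_ge0// ltW.
rewrite !addr_ge0 ?oppr_ge0//; first by rewrite divr_ge0// ltW.
by rewrite mulr_ge0// subr_ge0.
Qed.

End Evolution.
End Curvature.

(** * Geometric quantities in local coordinates *)

Lemma sum2 (R : zmodType) (F : 'I_2 -> R) : \sum_(i < 2) F i = F 0 + F 1.
Proof.
rewrite !big_ord_recl big_ord0 addr0; congr (_ + F _).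
exact: val_inj.
Qed.

Lemma ord2P (P : 'I_2 -> Prop) : P 0 -> P 1 -> forall i, P i.
Proof.
move=> P0 P1 [[|[|//]] Hi].
- by have -> : Ordinal Hi = 0 by exact: val_inj.
- by have -> : Ordinal Hi = 1 by exact: val_inj.
Qed.

Lemma invmx2 (R : fieldType) (A : 'M[R]_2) :
  A 0 0 * A 1 1 - A 0 1 * A 1 0 != 0 ->
  let d := A 0 0 * A 1 1 - A 0 1 * A 1 0 in
  [/\ invmx A 0 0 = A 1 1 / d, invmx A 0 1 = - (A 0 1 / d),
      invmx A 1 0 = - (A 1 0 / d) & invmx A 1 1 = A 0 0 / d].
Proof.
move=> d0 d; pose B : 'M[R]_2 := \matrix_(i, j)
  if i != j then - (A i j / d) else if i == 0 then A 1 1 / d else A 0 0 / d.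
have AB : A *m B = 1%:M.
  apply/matrixP; elim/ord2P; elim/ord2P; rewrite !mxE sum2 !mxE /d /=;
    by field.
have Au : A \in unitmx by have [] := mulmx1_unit AB.
have -> : invmx A = B by rewrite -[RHS](mulKmx Au) AB mulmx1.
by rewrite !mxE.
Qed.

Section LocalExpressions.
Variable R : realType.
Implicit Types (e u : expr R).

Definition axis_of (a : 'I_2) : axis := if a == 0 then X1 else X2.

Local Open Scope expr_scope.

(** Together with [christoffelE] and [ricciE], a formal copy of the coordinate definitions: the
    derivatives of Christoffel symbols inside the Ricci tensor become applications of [der]. *)
Definition invE i j : expr R := match i, j with
  X1, X1 => Jet 2 0 0 0 / detE R | X2, X2 => Jet 0 0 0 0 / detE R
  | _, _ => - (Jet 1 0 0 0 / detE R) end.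

Definition sumE (F : axis -> expr R) : expr R := F X1 + F X2.

Definition christoffelE k i j : expr R := sumE (fun l => Cst 2^-1 * invE k l *
  (der i (metricE R j l) + der j (metricE R i l) - der l (metricE R i j))).

Definition ricciE i j : expr R :=
  sumE (fun k => der k (christoffelE k i j) - der j (christoffelE k i k))
  + sumE (fun k => sumE (fun l =>
      christoffelE k k l * christoffelE l i j
      - christoffelE k j l * christoffelE l i k)).

Local Open Scope ring_scope.

Variables (U : set (R * 'rV[R]_2)).
Variable J : nat -> nat -> nat -> nat -> R * 'rV[R]_2 -> R.
Hypotheses (oU : open U) (HJ : forall n, jet_family U (J n)).
Variables (G : 'rV[R]_2 -> 'M[R]_2) (W : set 'rV[R]_2) (t : R).
Hypotheses (oW : open W) (WU : forall x, W x -> U (t, x)).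
Hypothesis GJ : forall x a b, W x ->
  G x a b = val J (metricE R (axis_of a) (axis_of b)) (t, x).
Hypothesis det_gt0 : forall z, U z -> 0 < val J (detE R) z.

Lemma pd_val (F : 'rV[R]_2 -> R) e (a : 'I_2) x : defined_on U J e ->
  (forall y, W y -> F y = val J e (t, y)) -> W x ->
  pd a F x = val J (der (axis_of a) e) (t, x).
Proof.
move=> De FE Wx; rewrite /pd (eq_open_derive _ oW Wx FE).
have [_ d] := val_derive HJ (axis_of a) De (WU Wx).
apply: (@derive_val _ _ _ _ _ _ _ _).
apply: (@is_derive_affine _ _ _ (fun y : 'rV[R]_2 => (t, y))) d => h.
rewrite /axis_of; elim/ord2P: a => /=; congr pair => /=.
all: by rewrite ?scaler0 ?add0r.
Qed.

Lemma invmx_val a b x : W x ->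
  invmx (G x) a b = val J (invE (axis_of a) (axis_of b)) (t, x).
Proof.
move=> Wx; have dd := lt0r_neq0 (det_gt0 (WU Wx)); rewrite /val /= in dd.
have [] := @invmx2 _ (G x); rewrite !GJ//.
by move: a b; elim/ord2P; elim/ord2P.
Qed.

Lemma defined_metricE i j : defined_on U J (metricE R i j).
Proof. by move=> z Uz; case: i; case: j. Qed.

Lemma defined_invE i j : defined_on U J (invE i j).
Proof.
move=> z Uz; have dd := lt0r_neq0 (det_gt0 Uz); rewrite /val /= in dd.
by case: i; case: j.
Qed.

Lemma defined_christoffelE k i j : defined_on U J (christoffelE k i j).
Proof.
move=> z Uz; have Di l := defined_invE k l Uz.
have Dm i' j' l : defined (jets_at J z) (der l (metricE R i' j')).
  by apply: defined_der; exact: defined_metricE Uz.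
by split; split; do ?split.
Qed.

Lemma christoffel_val k i j x : W x -> christoffel G k i j x =
  val J (christoffelE (axis_of k) (axis_of i) (axis_of j)) (t, x).
Proof.
move=> Wx; rewrite /christoffel sum2.
have pdG a b c : pd c (fun y => G y a b) x =
    val J (der (axis_of c) (metricE R (axis_of a) (axis_of b))) (t, x).
  by apply: pd_val Wx => [|y Wy]; [exact: defined_metricE | exact: GJ].
rewrite !pdG !invmx_val// mulrDr !mulrA.
by rewrite [axis_of 0]/= [axis_of 1]/=.
Qed.

Lemma ricci_val i j x : W x -> ricci G i j x =
  val J (ricciE (axis_of i) (axis_of j)) (t, x).
Proof.
move=> Wx; rewrite /ricci !sum2.
have pdC a b c d : pd d (christoffel G a b c) x = val J (der (axis_of d)
    (christoffelE (axis_of a) (axis_of b) (axis_of c))) (t, x).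
  apply: pd_val Wx; first exact: defined_christoffelE.
  by move=> y Wy; exact: christoffel_val.
by rewrite !pdC !christoffel_val// [axis_of 0]/= [axis_of 1]/=.
Qed.

(** The contracted Ricci tensor against Brioschi's formula: a rational identity in the derivatives
    of the metric up to order two. *)
Lemma scalar_curvature_val x : W x -> scalar_curvature G x = val J (scalE R) (t, x).
Proof.
move=> Wx; have := lt0r_neq0 (det_gt0 (WU Wx)).
rewrite /scalar_curvature !sum2 !ricci_val// !invmx_val//.
rewrite [axis_of 0]/= [axis_of 1]/= /val /=; generalize_jets => *.
by field.
Qed.

(** The trace of the Hessian against the divergence form; the two mixed derivatives are first
    identified by [der_comm]. *)
Lemma laplacian_val F u x : defined_on U J u ->
  (forall y, W y -> F y = val J u (t, y)) -> W x ->
  laplacian G F x = val J (lapE u) (t, x).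
Proof.
move=> Du FE Wx; have := lt0r_neq0 (det_gt0 (WU Wx)).
have pdF a y : W y -> pd a F y = val J (der (axis_of a) u) (t, y).
  by move=> Wy; exact: pd_val FE Wy.
have ppF a b : pd a (pd b F) x = val J (der (axis_of a) (der (axis_of b) u)) (t, x).
  by apply: pd_val (pdF b) Wx; exact: defined_on_der.
rewrite /laplacian /hessian !sum2 !ppF !pdF// !christoffel_val// !invmx_val//.
rewrite [axis_of 0]/= [axis_of 1]/= [val _ (der X2 (der X1 u)) _](der_comm X2 X1 (Du _ (WU Wx))).
rewrite /val /=; do !move: (eval _ (der _ _)) => ?; generalize_jets => *.
by field.
Qed.

Lemma sqnorm_gradient_val F u x : defined_on U J u ->
  (forall y, W y -> F y = val J u (t, y)) -> W x ->
  sqnorm G x (gradient G F x) = val J (gradE u u) (t, x).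
Proof.
move=> Du FE Wx; have := lt0r_neq0 (det_gt0 (WU Wx)).
have pdF a y : W y -> pd a F y = val J (der (axis_of a) u) (t, y).
  by move=> Wy; exact: pd_val FE Wy.
rewrite /sqnorm /gradient !sum2 !mxE !sum2 !pdF// !invmx_val// !GJ//.
rewrite [axis_of 0]/= [axis_of 1]/= /val /=.
do !move: (eval _ (der _ _)) => ?; generalize_jets => *.
by field.
Qed.

End LocalExpressions.

(** * Change of chart *)

Lemma within_open_continuous (S T : topologicalType) (A : set S) (f : S -> T) x :
  open A -> {within A, continuous f} -> A x -> {for x, continuous f}.
Proof.
move=> oA /subspace_continuousP cf Ax B /(cf _ Ax) /= AB.
have := open_nbhs_nbhs (conj oA Ax); move: AB; rewrite /nbhs /= /within /=.
by apply: filterS2 => y /[apply].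
Qed.

(** At a positive time the lifespan is a neighbourhood of [t], so the restricted limit is the
    ordinary derivative. *)
Lemma dt_interior (R : realType) (T : \bar R) (h : R -> R) (t l : R) :
  0 < t -> (t%:E < T)%E -> is_derive t 1 h l -> dt T h t = l.
Proof.
move=> t0 tT [dh <-]; rewrite /dt.
have lt : nbhs t (lifespan T).
  have [r tr rT] : exists2 r, t < r & (r%:E <= T)%E.
    case: T tT => [r|_|//]; first by rewrite lte_fin => tr; exists r.
    by exists (t + 1); rewrite ?leey// ltrDl.
  apply: filterS (near_in_itvoo (a := 0) (b := r) _); last by rewrite in_itv/= t0.
  move=> y; rewrite in_itv/= => /andP[y0 yr]; split; first exact: ltW.
  by apply: lt_le_trans rT; rewrite lte_fin.
have -> : within (lifespan T) t^' = t^'.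
  apply/seteqP; split=> A; last by apply: filterS => y.
  by apply: filterS2 (nbhs_dnbhs lt) => y Ly; apply.
apply: cvg_lim => //; apply/cvgrPdist_lt => e e0.
move/cvgrPdist_lt : dh => /(_ e e0).
rewrite /dnbhs /within /= => /nbhs_ballP[d d0 dP].
apply/nbhs_ballP; exists d => // s; rewrite /ball /= => ts sNt.
have := dP (s - t); rewrite /ball /= sub0r opprB => /(_ ts).
by rewrite subr_eq0 => /(_ sNt); rewrite [(s - t) *: 1]mulr1 subrK.
Qed.

(** The form is tested on (1, 0) and on (- A01, A00), where it equals A00 times the determinant. *)
Lemma positive_definite2 (R : realType) (A : 'M[R]_2) : positive_definite A ->
  [/\ A 1 0 = A 0 1, 0 < A 0 0 & 0 < A 0 0 * A 1 1 - A 0 1 * A 0 1].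
Proof.
move=> [sA pA]; have A10 : A 1 0 = A 0 1 by rewrite -[in RHS]sA mxE.
pose v x y : 'rV[R]_2 := \row_i if i == 0 then x else y.
have quad x y : (v x y *m A *m (v x y)^T) 0 0 =
    x ^+ 2 * A 0 0 + 2 * x * y * A 0 1 + y ^+ 2 * A 1 1.
  by rewrite !mxE sum2 !mxE !sum2 !mxE /= A10; ring.
have v0 x y : x != 0 \/ y != 0 -> v x y != 0.
  move=> xy; apply/eqP => /rowP E; move: xy (E 0) (E 1); rewrite !mxE /=.
  by move=> [/eqP|/eqP].
have A00 : 0 < A 0 0.
  have := pA (v 1 0) (v0 _ _ (or_introl (oner_neq0 _))); rewrite quad; lra.
split=> //; have := pA (v (- A 0 1) (A 0 0)) (v0 _ _ (or_intror (lt0r_neq0 A00))).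
rewrite quad (_ : _ + _ = A 0 0 * (A 0 0 * A 1 1 - A 0 1 * A 0 1)); last by ring.
by rewrite pmulr_rgt0.
Qed.

Lemma sqnorm_gradient2 (R : realType) (G : 'rV[R]_2 -> 'M[R]_2) F x :
  positive_definite (G x) -> sqnorm G x (gradient G F x) =
    (G x 1 1 * pd 0 F x ^+ 2 - 2 * G x 0 1 * pd 0 F x * pd 1 F x
     + G x 0 0 * pd 1 F x ^+ 2) / (G x 0 0 * G x 1 1 - G x 0 1 * G x 0 1).
Proof.
move=> /positive_definite2[G10 _ dG].
have [] := @invmx2 _ (G x); first by rewrite G10 lt0r_neq0.
rewrite /sqnorm /gradient !sum2 !mxE !sum2 G10 => -> -> -> ->.
move: (pd 0 F x) (pd 1 F x) (G x 0 0) (G x 0 1) (G x 1 1) dG => u v a b c dG.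
by field; exact: lt0r_neq0.
Qed.

(** With A = m B m^T and u = m D this is the invariance of the squared norm of a differential. The
    matrix m is invertible because det A = det B (det m)^2 is nonzero. *)
Lemma congruent_gram (R : fieldType) (A B : 'M[R]_2) (m : 'I_2 -> 'I_2 -> R)
    (D : 'I_2 -> R) :
  (forall a b, A a b = \sum_(c < 2) \sum_(d < 2) m a c * m b d * B c d) ->
  B 1 0 = B 0 1 ->
  A 0 0 * A 1 1 - A 0 1 * A 0 1 != 0 -> B 0 0 * B 1 1 - B 0 1 * B 0 1 != 0 ->
  let u a := m a 0 * D 0 + m a 1 * D 1 in
  (A 1 1 * u 0 ^+ 2 - 2 * A 0 1 * u 0 * u 1 + A 0 0 * u 1 ^+ 2)
    / (A 0 0 * A 1 1 - A 0 1 * A 0 1) =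
  (B 1 1 * D 0 ^+ 2 - 2 * B 0 1 * D 0 * D 1 + B 0 0 * D 1 ^+ 2)
    / (B 0 0 * B 1 1 - B 0 1 * B 0 1).
Proof.
move=> AB B10; rewrite /= !AB !sum2 B10.
move: (B 0 0) (B 0 1) (B 1 1) (D 0) (D 1) (m 0 0) (m 0 1) (m 1 0) (m 1 1).
move=> a b c u v m00 m01 m10 m11 + dj; set d := _ - _.
have -> : d = (a * c - b * b) * (m00 * m11 - m01 * m10) ^+ 2 by rewrite /d; ring.
rewrite mulf_eq0 negb_or (negbTE dj) /= expf_eq0 /= => dm.
by field; rewrite dj dm.
Qed.

Section ChangeOfChart.
Variables (R : realType) (M : surface R).
Implicit Types (i j : chart M) (p : M).

Definition codom i : set 'rV[R]_2 := cmap i @` dom i.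

Lemma codom_cmap i p : dom i p -> codom i (cmap i p).
Proof. by move=> ip; exists p. Qed.

Lemma cinvK i p : dom i p -> cinv i (cmap i p) = p.
Proof. by move=> ip; apply: cmapK; rewrite inE. Qed.

Lemma cmap_at i p : dom i p -> {for p, continuous (cmap i)}.
Proof.
by move=> ip; exact: within_open_continuous (@open_dom _ _ i) (@cmap_continuous _ _ i) ip.
Qed.

Lemma cinv_at i x : codom i x -> {for x, continuous (cinv i)}.
Proof.
exact: (@within_open_continuous _ _ (codom i) (cinv i) x (@open_codom _ _ i)
  (@cinv_continuous _ _ i)).
Qed.

Lemma near_overlap i j p : dom i p -> dom j p ->
  \forall x \near cmap i p, codom i x /\ dom j (cinv i x).
Proof.
move=> ip jp; have ic := codom_cmap ip; apply: filterI.
  have oc : open (codom i) := @open_codom _ _ i.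
  exact: (near_open oc ic).
by apply: (cinv_at ic); rewrite cinvK//; exact: open_nbhs_nbhs (conj (@open_dom _ _ j) jp).
Qed.

Lemma transition_derivable i j p b v : dom i p -> dom j p ->
  derivable (transition i j b) (cmap i p) v.
Proof.
move=> ip jp.
have [U [G [oU Ux kG GE]]] := @transition_smooth _ M i j (cmap i p)
  (ex_intro2 _ _ p (conj ip jp) erefl).
have [_ /(_ v)[dG _]] := kG 1%N.
suff /derivable_mxP/(_ 0 b) : derivable (cmap j \o cinv i) (cmap i p) v by [].
apply: near_eq_derivable (dG _ Ux).
near=> x; apply: GE; rewrite inE; split.
  by near: x; exact: near_open oU Ux _.
have [[q iq <-] jq] : codom i x /\ dom j (cinv i x).
  by near: x; exact: near_overlap.
by exists q => //; split=> //; rewrite -(cinvK iq).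
Unshelve. all: by end_near.
Qed.

(** A coordinate line of chart [i] is read in chart [j] as a curve with displacement [c], and
    [jet_derive_curve] applies to it. Regularity of [h] is required in chart [j] only. *)
Lemma pd_change_of_chart i j p (h : M -> R) a (U : set (R * 'rV[R]_2)) J t :
  dom i p -> dom j p -> open U -> jet_family U J -> U (t, cmap j p) ->
  (forall x, codom j x -> J 0%N 0%N 0%N (t, x) = h (cinv j x)) ->
  pd a (h \o cinv i) (cmap i p) =
    pd a (transition i j 0) (cmap i p) * pd 0 (h \o cinv j) (cmap j p)
    + pd a (transition i j 1) (cmap i p) * pd 1 (h \o cinv j) (cmap j p).
Proof.
move=> ip jp oU UJ Ux Jh.
set x := cmap i p; set y := cmap j p; pose e : 'rV[R]_2 := delta_mx 0 a.
have yE : y = cmap j (cinv i x) by rewrite /x cinvK.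
pose c b s := transition i j b (x + s *: e) - y 0 b.
have dc b : is_derive (0 : R) 1 (c b) (pd a (transition i j b) x).
  rewrite -[pd _ _ _]subr0; apply: is_deriveB; apply: is_derive_line.
  by rewrite scale0r addr0; apply: derivableP; exact: transition_derivable.
have c0 b : c b 0 = 0 by rewrite /c scale0r addr0 /transition -yE subrr.
have := jet_derive_curve 0 0 0 oU UJ Ux (c0 0) (c0 1) (dc 0) (dc 1).
have pdJ b l : is_derive (t, y) (axis_vec R (axis_of b)) (J 0%N 0%N 0%N) l ->
    pd b (h \o cinv j) y = l.
  move=> d; have : 'D_(delta_mx 0 b) (fun z => J 0%N 0%N 0%N (t, z)) y = l.
    apply: (@derive_val _ _ _ _ _ _ _ _).
    apply: (@is_derive_affine _ _ _ (fun z : 'rV[R]_2 => (t, z))) d => r.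
    rewrite /axis_of; elim/ord2P: b => /=; congr pair => /=;
      by rewrite ?scaler0 ?add0r.
  move=> <-; apply: (eq_open_derive _ (@open_codom _ _ j) (codom_cmap jp)) => z jz.
  by rewrite Jh.
have [_ _ d1 d2] := UJ 0%N 0%N 0%N _ Ux.
rewrite -(pdJ 0 _ d1) -(pdJ 1 _ d2) => D.
have curve s : y + (c 0 s *: delta_mx 0 0 + c 1 s *: delta_mx 0 1) =
    cmap j (cinv i (x + s *: e)).
  apply/rowP; elim/ord2P; rewrite !mxE /c /transition /=;
    by rewrite ?mulr0 ?mulr1 ?addr0 ?add0r addrC subrK.
have : is_derive x e (fun z => J 0%N 0%N 0%N (t, cmap j (cinv i z)))
   (pd a (transition i j 0) x * pd 0 (h \o cinv j) y
    + pd a (transition i j 1) x * pd 1 (h \o cinv j) y).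
  apply: is_derive_of_line; move: D.
  by under eq_fun do rewrite curve.
move=> [_ <-]; apply: near_eq_derive; near=> z.
have [iz jz] : codom i z /\ dom j (cinv i z).
  by near: z; exact: near_overlap.
by rewrite /= Jh ?cinvK//; exact: codom_cmap.
Unshelve. all: by end_near.
Qed.

Lemma sqnorm_grad_chart (g : tensor M) i j p (h : M -> R) U J t :
  tensorial g -> (forall i p, dom i p -> positive_definite (g i (cmap i p))) ->
  dom i p -> dom j p -> open U -> jet_family U J -> U (t, cmap j p) ->
  (forall x, codom j x -> J 0%N 0%N 0%N (t, x) = h (cinv j x)) ->
  sqnorm_grad g i h p = sqnorm_grad g j h p.
Proof.
move=> tg pg ip jp oU UJ Ux Jh; rewrite /sqnorm_grad !sqnorm_gradient2; try exact: pg.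
rewrite !(pd_change_of_chart _ ip jp oU UJ Ux Jh).
have [_ _ /lt0r_neq0 di] := positive_definite2 (pg _ _ ip).
have [gj10 _ /lt0r_neq0 dj] := positive_definite2 (pg _ _ jp).
exact: (@congruent_gram _ (g i (cmap i p)) (g j (cmap j p))
  (fun a c => pd a (transition i j c) (cmap i p))
  (fun c => pd c (h \o cinv j) (cmap j p)) (tg i j p ip jp) gj10 di dj).
Qed.

End ChangeOfChart.

(** * Maximum principle *)

Section OneVariable.
Variable R : realType.
Implicit Types phi : R -> R.

Lemma derive_quotient phi (x l e : R) : is_derive x 1 phi l -> 0 < e ->
  exists2 d : R, 0 < d & forall h, h != 0 -> `|h| < d ->
    `|l - h^-1 * (phi (x + h) - phi x)| < e.
Proof.
move=> [+ <-] e0 => /cvgrPdist_lt/(_ e e0).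
rewrite /dnbhs /within /= => /nbhs_ballP[d d0 dP]; exists d => // h h0 hd.
have := dP h; rewrite /ball /= sub0r normrN => /(_ hd h0).
by rewrite [h *: 1]mulr1 (addrC h).
Qed.

(** One-sided, because the minimum over the time interval may be attained at its right end. *)
Lemma derive_at_left_min phi (a x l : R) : a < x -> is_derive x 1 phi l ->
  (forall r : R, a <= r <= x -> phi x <= phi r) -> l <= 0.
Proof.
move=> ax dphi xmin; rewrite leNgt; apply/negP => l0.
have [d d0 dP] := derive_quotient dphi l0.
pose h := Num.min d (x - a) / 2.
have m0 : 0 < Num.min d (x - a) by rewrite lt_min d0 subr_gt0.
have h0 : 0 < h by rewrite divr_gt0.
have : h < Num.min d (x - a) by rewrite /h; lra.
rewrite lt_min => /andP[hd hxa].
have := dP (- h); rewrite oppr_eq0 (gt_eqF h0) normrN gtr0_norm// => /(_ isT hd).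
have : phi x <= phi (x - h) by apply: xmin; lra.
rewrite invrN mulNr opprK => le; have : 0 <= h^-1 * (phi (x - h) - phi x).
  by rewrite mulr_ge0 ?subr_ge0// invr_ge0 ltW.
by move=> q0; rewrite gtr0_norm; lra.
Qed.

(** If l < 0, then [phi1], which vanishes at 0, is negative just to the right of it, and the mean
    value theorem makes [phi] drop below its minimum. *)
Lemma second_derivative_at_min phi phi1 (l d : R) : 0 < d ->
  (forall r : R, `|r| < d -> is_derive r 1 phi (phi1 r)) ->
  is_derive (0 : R) 1 phi1 l -> (forall r : R, `|r| < d -> phi 0 <= phi r) ->
  phi1 0 = 0 /\ 0 <= l.
Proof.
move=> d0 dphi dphi1 min0.
have itv (r : R) : r \in `](- d), d[ -> `|r| < d by rewrite in_itv/= ltr_norml.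
have phi10 : phi1 0 = 0.
  have [|_ <-] := dphi 0; first by rewrite normr0.
  have [|r /itv/dphi[]|| r /itv/min0|] // := @derive1_at_min R phi (- d) d 0.
    by lra.
  by rewrite in_itv/= oppr_lt0 d0.
split=> //; rewrite leNgt; apply/negP => l0.
have Nl0 : 0 < - l by rewrite oppr_gt0.
have [e e0 eP] := derive_quotient dphi1 Nl0.
pose h := Num.min d e / 2.
have m0 : 0 < Num.min d e by rewrite lt_min d0.
have h0 : 0 < h by rewrite divr_gt0.
have : h < Num.min d e by rewrite /h; lra.
rewrite lt_min => /andP[hd he].
have itv0 (r : R) : r \in `[0, h] -> `|r| < d.
  by rewrite in_itv/= => /andP[r0 rh]; rewrite ger0_norm// (le_lt_trans rh).
have [||c cI E] := @MVT R phi phi1 0 h h0.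
- by move=> r rI; apply/dphi/itv0/subset_itv_oo_cc.
- by apply: derivable_within_continuous => r /itv0/dphi[].
have c0 : 0 < c by rewrite (itvP cI).
have cd : `|c| < d by apply/itv0/subset_itv_oo_cc.
have ce : `|c| < e by rewrite gtr0_norm// (lt_trans _ he)// (itvP cI).
have := eP c (lt0r_neq0 c0) ce; rewrite add0r phi10 subr0 => q.
have p1 : phi1 c < 0.
  have : c^-1 * phi1 c < 0 by move: q; rewrite ltr_norml; lra.
  by rewrite pmulr_rlt0// invr_gt0.
have : phi h - phi 0 < 0 by rewrite E subr0 nmulr_rlt0.
by rewrite subr_lt0 ltNge min0// gtr0_norm.
Qed.

End OneVariable.

Section JetLines.
Variables (R : realType) (U : set (R * 'rV[R]_2)).
Variable J : nat -> nat -> nat -> R * 'rV[R]_2 -> R.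
Hypotheses (oU : open U) (UJ : jet_family U J).

Let dir (a b : R) : 'rV[R]_2 := a *: delta_mx 0 0 + b *: delta_mx 0 1.

Lemma jet_derive_line p q s t x (a b r : R) : U (t, x + r *: dir a b) ->
  is_derive r 1 (fun r => J p q s (t, x + r *: dir a b))
    (a * J p q.+1 s (t, x + r *: dir a b) + b * J p q s.+1 (t, x + r *: dir a b)).
Proof.
move=> Ux; apply: is_derive_of_line.
have dl (m : R) : is_derive (0 : R) 1 (fun h : R => h * m) m.
  apply: (@is_derive_affine R R R (fun h : R => h * m) id 0 1 m m).
    by move=> h; rewrite mulrDl [h *: 1]mulr1.
have := jet_derive_curve p q s oU UJ Ux (mul0r a) (mul0r b) (dl a) (dl b).
set f := (fun h : R => _); set g := (fun h : R => _).
have -> // : f = g; apply/funext => h; rewrite /f /g; congr (J _ _ _ (_, _)).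
by rewrite [h *: 1]mulr1 scalerDl -!addrA [h *: dir _ _]scalerDr !scalerA.
Qed.

Lemma jet_derive_time p q s (t : R) x : U (t, x) ->
  is_derive t 1 (fun r => J p q s (r, x)) (J p.+1 q s (t, x)).
Proof.
move=> Ux; have [_ d _ _] := UJ p q s Ux.
apply: (@is_derive_affine _ _ _ (fun r : R => (r, x))) d => h.
by congr pair => /=; rewrite scaler0 add0r.
Qed.

Lemma jet_spatial_min t x : U (t, x) ->
  (\forall y \near x, J 0 0 0 (t, x) <= J 0 0 0 (t, y)) ->
  spatial_min (fun p q r => J p q r (t, x)).
Proof.
move=> Ux xmin.
have Uy : \forall y \near x, U (t, y).
  have [[P Q] /= [tP xQ] PQ] : nbhs (t, x) U.
    exact: open_nbhs_nbhs (conj oU Ux).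
  by apply: filterS xQ => y Qy; apply: (PQ (t, y)); split=> //; exact: nbhs_singleton tP.
have main (a b : R) : a * J 0 1 0 (t, x) + b * J 0 0 1 (t, x) = 0 /\
    0 <= a ^+ 2 * J 0 2 0 (t, x) + 2 * a * b * J 0 1 1 (t, x)
         + b ^+ 2 * J 0 0 2 (t, x).
  (* A zero second direction reduces the plane to the line through [x] along [dir a b]. *)
  have [d d0 dP] := @near_plane _ _ _ _ (dir a b) 0 (filterI Uy xmin).
  have {dP}dP (r : R) : `|r| < d -> U (t, x + r *: dir a b) /\
      J 0 0 0 (t, x) <= J 0 0 0 (t, x + r *: dir a b).
    by move=> rd; have := dP r 0 rd; rewrite normr0 scaler0 addr0 => /(_ d0).
  have x0 : x + (0 : R) *: dir a b = x by rewrite scale0r addr0.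
  have Ux0 : U (t, x + (0 : R) *: dir a b) by rewrite x0.
  pose phi (r : R) := J 0 0 0 (t, x + r *: dir a b).
  pose phi1 (r : R) := a * J 0 1 0 (t, x + r *: dir a b) + b * J 0 0 1 (t, x + r *: dir a b).
  have d1 (r : R) : `|r| < d -> is_derive r 1 phi (phi1 r).
    by move=> /dP[Ur _]; exact: jet_derive_line.
  have d2 : is_derive (0 : R) 1 phi1 (a ^+ 2 * J 0 2 0 (t, x)
      + 2 * a * b * J 0 1 1 (t, x) + b ^+ 2 * J 0 0 2 (t, x)).
    have D := is_deriveD (is_deriveZ a (jet_derive_line 0 1 0 Ux0))
                         (is_deriveZ b (jet_derive_line 0 0 1 Ux0)).
    apply: is_derive_eq D _; rewrite /GRing.scale /= x0; ring.
  have [] := second_derivative_at_min d0 d1 d2.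
    by move=> r /dP[_]; rewrite /phi x0.
  by rewrite /phi1 x0.
split=> [||a b].
- by have [] := main 1 0; rewrite mul1r mul0r addr0.
- by have [] := main 0 1; rewrite mul1r mul0r add0r.
- by have [] := main a b.
Qed.

End JetLines.

Section MaximumPrinciple.
Variables (R : realType) (M : surface R) (T : \bar R).
Hypothesis closedM : closed_surface M.

(** Leaving out the initial time makes the set open, so that two-sided time derivatives of all
    orders exist on it. *)
Definition cylinder (i : chart M) : set (R * 'rV[R]_2) :=
  [set z | [/\ 0 < z.1, (z.1%:E < T)%E & codom i z.2]].

Lemma open_times : open [set t : R | 0 < t /\ (t%:E < T)%E].
Proof.
case: T => [r||].
- have -> : [set t : R | 0 < t /\ (t%:E < r%:E)%E] = [set` `]0, r[].
    by apply/seteqP; split=> t /=; rewrite in_itv/= lte_fin => /andP.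
  exact: interval_open.
- have -> : [set t : R | 0 < t /\ (t%:E < +oo)%E] = [set` `]0, +oo[].
    by apply/seteqP; split=> t /=; rewrite in_itv/= andbT ?ltry => -[].
  exact: interval_open.
- have -> : [set t : R | 0 < t /\ (t%:E < -oo)%E] = set0.
    by apply/seteqP; split=> t //= [].
  exact: open0.
Qed.

Lemma open_cylinder i : open (cylinder i).
Proof.
have -> : cylinder i = (fst @^-1` [set t : R | 0 < t /\ (t%:E < T)%E])
    `&` (snd @^-1` codom i).
  by apply/seteqP; split=> z /=; [move=> [] | move=> [[]]].
apply: openI; apply: open_comp.
- by move=> z _; exact: cvg_fst.
- exact: open_times.
- by move=> z _; exact: cvg_snd.
- exact: (@open_codom _ _ i).
Qed.

Lemma cylinder_cmap i t p : 0 < t -> (t%:E < T)%E -> dom i p ->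
  cylinder i (t, cmap i p).
Proof. by move=> t0 tT ip; split=> //; exact: codom_cmap. Qed.

(* Riccati comparison: at a negative minimum of [(t - tau) K + 1] over
   [tau, t1] x M one would have both [K + (t - tau) K_t <= 0] and
   [K ^ 2 <= K_t]. *)
Lemma riccati_maximum_principle (K : R -> M -> R) (tau : R) : 0 < tau ->
  (forall i, exists J, [/\ jet_family (cylinder i) J,
    forall t p, 0 < t -> (t%:E < T)%E -> dom i p ->
      J 0 0 0 (t, cmap i p) = K t p &
    forall t p, tau < t -> (t%:E < T)%E -> dom i p ->
      spatial_min (fun p' q r => J p' q r (t, cmap i p)) ->
      K t p < - (t - tau)^-1 -> K t p ^+ 2 <= J 1 0 0 (t, cmap i p)]) ->
  forall t p, tau < t -> (t%:E < T)%E -> - (t - tau)^-1 <= K t p.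
Proof.
move=> tau0 HK t1 p1 tt1 t1T; rewrite leNgt; apply/negP => K1.
pose f (z : R * M) := (z.1 - tau) * K z.1 z.2 + 1.
pose A : set (R * M) := `[tau, t1]%classic `*` [set: M].
have f_lt0 t p : tau < t -> (f (t, p) < 0) = (K t p < - (t - tau)^-1).
  move=> tt; have tt0 : 0 < t - tau by rewrite subr_gt0.
  by rewrite /f /= -[RHS](ltr_pM2l tt0) mulrN divff ?gt_eqF// ltrNr -subr_lt0 opprK addrC.
have A0 : A !=set0 by exists (t1, p1); split=> //=; rewrite in_itv/= (ltW tt1) lexx.
have cA : compact A by apply: compact_setX; [exact: segment_compact | exact: closedM].
have cf : {within A, continuous f}.
  apply: continuous_in_subspaceT => -[s q]; rewrite inE => -[/=].
  rewrite in_itv/= => /andP[ts st1] _.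
  have s0 : 0 < s := lt_le_trans tau0 ts.
  have sT : (s%:E < T)%E by apply: le_lt_trans t1T; rewrite lee_fin.
  have [i iq] := dom_cover q; have [J [HJ JK _]] := HK i.
  have [cJ _ _ _] := HJ 0 0 0 _ (cylinder_cmap s0 sT iq).
  have cK : {for (s, q), continuous (fun z : R * M => K z.1 z.2)}.
    have E : \forall z \near (s, q), J 0 0 0 (z.1, cmap i z.2) = K z.1 z.2.
      exists ([set t : R | 0 < t /\ (t%:E < T)%E], dom i).
        split; [apply: open_nbhs_nbhs; split=> //; exact: open_times|].
        by apply: open_nbhs_nbhs; split=> //; exact: open_dom.
      by move=> [a b] [/= [a0 aT] ib]; exact: JK.
    rewrite /prop_for /continuous_at /= -(JK _ _ s0 sT iq).
    apply: cvg_trans (near_eq_cvg E) _.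
    have cc : {for (s, q), continuous (fun z : R * M => (z.1, cmap i z.2))}.
      move=> B [[P Q] /= [sP xQ] PQ]; exists (P, cmap i @^-1` Q).
        by split=> //; exact: (cmap_at iq xQ).
      by move=> z [Pz Qz]; exact: PQ.
    exact: (continuous_comp cc cJ).
  apply: cvgD; last exact: cvg_cst.
  apply: cvgM cK; apply: cvgD; [exact: cvg_fst | exact: cvg_cst].
have [[s q] sqA fmin] := compact_EVT_min A0 cA cf.
have fsq : f (s, q) < 0.
  apply: le_lt_trans (fmin (t1, p1) _) _; last by rewrite f_lt0.
  by rewrite inE; split=> //=; rewrite in_itv/= (ltW tt1) lexx.
move: sqA; rewrite inE => -[/=]; rewrite in_itv/= => /andP[ts st1] _.
(* At time [tau] the function equals 1, so a negative minimum is attained later. *)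
have {}ts : tau < s.
  rewrite lt_neqAle ts andbT; apply/eqP => E; move: fsq.
  by rewrite /f /= E subrr mul0r add0r ltr10.
have s0 : 0 < s := lt_trans tau0 ts.
have sT : (s%:E < T)%E by apply: le_lt_trans t1T; rewrite lee_fin.
have {}fmin a b : tau <= a <= t1 -> f (s, q) <= f (a, b).
  by move=> ab; apply: fmin; rewrite inE.
have st0 : 0 < s - tau by rewrite subr_gt0.
have [i iq] := dom_cover q; have [J [HJ JK Kt]] := HK i.
have Cx := cylinder_cmap s0 sT iq.
have smin : spatial_min (fun p' q' r => J p' q' r (s, cmap i q)).
  apply: (@jet_spatial_min _ _ _ (@open_cylinder i) HJ _ _ Cx).
  apply: (near_open (@open_codom _ _ i) (codom_cmap iq)) => y iy.
  have [b ib <-] := iy; rewrite !JK//.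
  have := fmin s b; rewrite (ltW ts) st1 /f /= => /(_ isT).
  by rewrite lerD2r ler_pM2l.
have Ks : K s q < - (s - tau)^-1 by rewrite -f_lt0.
have := Kt s q ts sT iq smin Ks.
have D : is_derive s 1 (fun r => (r - tau) * J 0 0 0 (r, cmap i q) + 1)
    (K s q + (s - tau) * J 1 0 0 (s, cmap i q)).
  have d1 := jet_derive_time HJ 0 0 0 Cx.
  have d2 : is_derive s 1 (fun r => r - tau) (1 - 0).
    exact: is_deriveB.
  have := is_deriveD (is_deriveM d2 d1) (is_derive_cst (1 : R) s 1).
  move=> D; apply: is_derive_eq D _.
  by rewrite /GRing.scale /= JK//; ring.
have := derive_at_left_min ts D; rewrite JK// => H.
have {}H : K s q + (s - tau) * J 1 0 0 (s, cmap i q) <= 0.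
  apply: H => r /andP[tr rs].
  rewrite JK//; first by apply: (fmin r q); rewrite tr (le_trans rs).
    exact: lt_le_trans tr.
  by apply: le_lt_trans sT; rewrite lee_fin.
move: (J 1 0 0 _) H fsq => k H fsq Kk.
have Kneg : K s q < 0.
  by apply: lt_trans Ks _; rewrite oppr_lt0 invr_gt0.
(* K and (s - tau) K + 1 are both negative, so K + (s - tau) K^2 > 0; with K^2 <= K_t this
   contradicts K + (s - tau) K_t <= 0. *)
have := mulr_gt0 (_ : 0 < - K s q) (_ : 0 < - f (s, q)).
rewrite !oppr_gt0 => /(_ Kneg fsq); rewrite /f /= mulrNN => p.
have := ler_wpM2l (ltW st0) Kk; lra.
Qed.

End MaximumPrinciple.

(** * The Harnack inequalities *)

Lemma oppV_ge_limit (R : realType) (t k : R) : 0 < t ->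
  (forall tau, 0 < tau < t -> - (t - tau)^-1 <= k) -> - t^-1 <= k.
Proof.
move=> t0 H; rewrite leNgt; apply/negP => kt.
have tV0 : 0 < t^-1 by rewrite invr_gt0.
have k0 : 0 < - k by lra.
have kV : (- k)^-1 < t by rewrite -(invrK t) ltf_pV2 ?posrE//; lra.
have kV0 : 0 < (- k)^-1 by rewrite invr_gt0.
(* Half the gap between 1/(-k) and t, so that t - tau still exceeds 1/(-k). *)
pose tau := (t - (- k)^-1) / 2.
have := H tau; rewrite /tau => /(_ _) h.
have {}h := h ltac:(lra).
have d0 : 0 < t - tau by rewrite /tau; lra.
have : (t - tau)^-1 < - k.
  by rewrite -(invrK (- k)) ltf_pV2 ?posrE//; rewrite /tau; lra.
by rewrite /tau; lra.
Qed.

Section Harnack.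
Variables (R : realType) (eps : R) (M : surface R) (T : \bar R).
Variables (g : R -> tensor M).
Hypotheses (eps_ge0 : 0 <= eps) (closedM : closed_surface M).
Hypothesis flow : eps_ricci_flow T eps g.
Hypothesis scal_gt0 : forall t, lifespan T t -> forall (i : chart M) (p : M),
  dom i p -> 0 < scal (g t) i p.

Implicit Types (i j : chart M).
Notation cyl := (cylinder T).
Notation g11 := (@Jet R 0 0 0 0).
Notation w := (@Jet R 3 0 0 0).
Notation s := (@Jet R 4 0 0 0).
Notation k := (@Jet R 5 0 0 0).

(* Only the functions 0, 1, 2 and 4 are constrained. *)
Definition flow_jets (i : chart M) J :=
  [/\ forall n, jet_family (cyl i) (J n),
      forall t x a b, cyl i (t, x) ->
        g t i x a b = val J (metricE R (axis_of a) (axis_of b)) (t, x),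
      forall n z, (n < 3)%N -> cyl i z ->
        J n 1%N 0%N 0%N z = - eps * val J s z * J n 0%N 0%N 0%N z,
      forall z, cyl i z -> val J s z = val J (scalE R) z &
      forall z, cyl i z ->
        [/\ 0 < val J g11 z, 0 < val J (detE R) z & 0 < val J s z]].

(** Installs the jets of an expression, evaluated in the old family, as the n-th function. *)
Definition upd J n (e : expr R) : nat -> nat -> nat -> nat -> R * 'rV[R]_2 -> R :=
  fun m => if m == n then expr_jets J e else J m.

Lemma lifespan_interior t : 0 < t -> (t%:E < T)%E -> lifespan T t.
Proof. by move=> t0 tT; split=> //; exact: ltW. Qed.

Lemma cylinder_point i z : cyl i z -> exists2 p, dom i p & z.2 = cmap i p.
Proof. by move=> [_ _ [p ip <-]]; exists p. Qed.

Lemma upd_jet_family i J n e : (forall m, jet_family (cyl i) (J m)) ->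
  defined_on (cyl i) J e -> forall m, jet_family (cyl i) (upd J n e m).
Proof.
move=> HJ De m; rewrite /upd; case: eqP => // _.
exact: (expr_jet_family (@open_cylinder _ _ T i) HJ De).
Qed.

Lemma flow_jets_upd i J n e : n = 3%N \/ n = 5%N -> flow_jets i J ->
  defined_on (cyl i) J e -> flow_jets i (upd J n e).
Proof.
move=> n35 [HJ gJ fJ sJ pJ] De.
split; first exact: upd_jet_family.
- by case: n35 => -> t x a b C; rewrite gJ//; case: (axis_of a); case: (axis_of b).
- by case: n35 => -> [|[|[|//]]] z n3 C; exact: fJ.
- by case: n35 => -> z C; exact: sJ.
- by case: n35 => -> z C; exact: pJ.
Qed.

Lemma metric_jets i a b : exists2 J, jet_family (cyl i) J &
  J 0%N 0%N 0%N = (fun z : R * 'rV[R]_2 => g z.1 i z.2 a b).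
Proof.
have [[_ _ sg] _] := flow; have oC := @open_cylinder _ _ T i.
apply: (smooth_jets oC); apply: (smooth_on_open oC _ (sg i a b)).
by move=> z [z0 zT iz]; split=> //; exact: lifespan_interior.
Qed.

Lemma metric_derive i p t a b : 0 < t -> (t%:E < T)%E -> dom i p ->
  is_derive t 1 (fun r => g r i (cmap i p) a b)
    (- eps * scal (g t) i p * g t i (cmap i p) a b).
Proof.
move=> t0 tT ip; have [J HJ JE] := metric_jets i a b.
have := jet_derive_time HJ 0 0 0 (cylinder_cmap t0 tT ip); rewrite {1}JE /= => d.
have [_ fl] := flow; have <- := fl _ (lifespan_interior t0 tT) i p ip a b.
by rewrite (dt_interior t0 tT d).
Qed.

(** The jets of the scalar curvature are those of the expression [scalE] in the metric, so its
    smoothness comes from that of the metric. Slot 6 is kept for a further function, later the heat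
    solution. *)
Lemma flow_jets_exist i F : jet_family (cyl i) F ->
  exists2 J, flow_jets i J & J 6 = F.
Proof.
move=> HF; have [[_ pg _] _] := flow.
have [J0 HJ0 J0E] := metric_jets i 0 0.
have [J1 HJ1 J1E] := metric_jets i 0 1.
have [J2 HJ2 J2E] := metric_jets i 1 1.
(* [F] is meant for slot 6; in slots 3, 4 and 5 it is a placeholder, replaced by w, the curvature
   and K. *)
pose B n := match n with 0 => J0 | 1 => J1 | 2 => J2 | _ => F end.
have HB n : jet_family (cyl i) (B n) by case: n => [|[|[|n]]].
have pgz z : cyl i z -> positive_definite (g z.1 i z.2).
  move=> [z0 zT [p ip <-]]; exact: pg (lifespan_interior z0 zT) _ _ ip.
have gB t x a b : cyl i (t, x) ->
    g t i x a b = val B (metricE R (axis_of a) (axis_of b)) (t, x).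
  move=> /pgz /= /positive_definite2[g10 _ _].
  have V n : val B (Jet n 0 0 0) (t, x) = B n 0 0 0 (t, x) by [].
  move: a b; elim/ord2P; elim/ord2P; rewrite /axis_of /metricE /= V /=.
  - by rewrite J0E.
  - by rewrite J1E.
  - by rewrite g10 J1E.
  - by rewrite J2E.
have pB z : cyl i z -> 0 < val B g11 z /\ 0 < val B (detE R) z.
  move=> Cz; have [_ + +] := positive_definite2 (pgz _ Cz).
  have V a b := gB z.1 z.2 a b; rewrite -surjective_pairing in V.
  by rewrite !V.
have dB z : cyl i z -> 0 < val B (detE R) z by move=> /pB[].
have scB t x : cyl i (t, x) -> scalar_curvature (g t i) x = val B (scalE R) (t, x).
  move=> [/= t0 tT ix].
  apply: (scalar_curvature_val HB (@open_codom _ _ i) _ _ dB ix) => [y iy|y a b iy].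
    by split.
  by apply: gB; split.
have DsB : defined_on (cyl i) B (scalE R) by exact: defined_scalE dB.
exists (upd B 4 (scalE R)); last by [].
split; first exact: upd_jet_family.
- by move=> t x a b C; rewrite gB//; case: (axis_of a); case: (axis_of b).
- move=> n z n3 Cz.
  have -> : val (upd B 4 (scalE R)) s z = val B (scalE R) z by [].
  have [p ip zp] := cylinder_point Cz; have [z0 zT _] := Cz.
  have zE : z = (z.1, cmap i p) by rewrite -zp -surjective_pairing.
  have Cz' : cyl i (z.1, cmap i p) by rewrite -zE.
  have dt_val (J : nat -> nat -> nat -> R * 'rV[R]_2 -> R) a b :
      jet_family (cyl i) J -> J 0 0 0 = (fun z : R * 'rV[R]_2 => g z.1 i z.2 a b) ->
      J 1 0 0 z = - eps * val B (scalE R) z * J 0 0 0 z.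
    move=> HJ JE; have := jet_derive_time HJ 0 0 0 Cz'; rewrite {1}JE /= -zE.
    move=> [_ <-]; have [_ ->] := metric_derive a b z0 zT ip.
    by rewrite /scal scB// -zE JE /= zp.
  by move: n3; case: n => [|[|[|//]]] _; [exact: dt_val HJ0 J0E | exact: dt_val HJ1 J1E
    | exact: dt_val HJ2 J2E].
- by [].
- move=> z Cz; have [p1 p2] := pB _ Cz; split=> //.
  have -> : val (upd B 4 (scalE R)) s z = val B (scalE R) z by [].
  have [p ip zp] := cylinder_point Cz; have [z0 zT _] := Cz.
  have zE : z = (z.1, cmap i p) by rewrite -zp -surjective_pairing.
  by rewrite zE -scB -?zE//; exact: scal_gt0 (lifespan_interior z0 zT) i p ip.
Qed.

Section Values.
Variables (i : chart M) (J : nat -> nat -> nat -> nat -> R * 'rV[R]_2 -> R).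
Hypothesis FJ : flow_jets i J.
Variables (t : R) (p : M).
Hypotheses (t0 : 0 < t) (tT : (t%:E < T)%E) (ip : dom i p).

Let HJ n : jet_family (cyl i) (J n). Proof. by have [] := FJ. Qed.
Let dJ z : cyl i z -> 0 < val J (detE R) z.
Proof. by have [_ _ _ _ +] := FJ => /[apply] -[]. Qed.
Let WU x : codom i x -> cyl i (t, x). Proof. by []. Qed.
Let gJ x a b : codom i x ->
  g t i x a b = val J (metricE R (axis_of a) (axis_of b)) (t, x).
Proof. by move=> ix; have [_ + _ _ _] := FJ; apply. Qed.

Lemma scal_val : scal (g t) i p = val J s (t, cmap i p).
Proof.
have [_ _ _ sJ _] := FJ; rewrite (sJ _ (cylinder_cmap t0 tT ip)).
exact: (scalar_curvature_val HJ (@open_codom _ _ i) WU gJ dJ (codom_cmap ip)).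
Qed.

Lemma lap_val (h : M -> R) u : defined_on (cyl i) J u ->
  (forall q, dom i q -> h q = val J u (t, cmap i q)) ->
  lap (g t) i h p = val J (lapE u) (t, cmap i p).
Proof.
move=> Du hu; apply: (laplacian_val HJ (@open_codom _ _ i) WU gJ dJ Du _ (codom_cmap ip)).
by move=> y [q iq <-] /=; rewrite cinvK// hu.
Qed.

Lemma sqnorm_grad_val (h : M -> R) u : defined_on (cyl i) J u ->
  (forall q, dom i q -> h q = val J u (t, cmap i q)) ->
  sqnorm_grad (g t) i h p = val J (gradE u u) (t, cmap i p).
Proof.
move=> Du hu; apply: (sqnorm_gradient_val HJ (@open_codom _ _ i) WU gJ dJ Du _ (codom_cmap ip)).
by move=> y [q iq <-] /=; rewrite cinvK// hu.
Qed.

Lemma sqnorm_grad_indep (h : M -> R) j n : dom j p ->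
  (forall q, dom i q -> h q = J n 0%N 0%N 0%N (t, cmap i q)) ->
  sqnorm_grad (g t) j h p = sqnorm_grad (g t) i h p.
Proof.
move=> jp hu; have [[tg pg _] _] := flow; have L := lifespan_interior t0 tT.
apply: (sqnorm_grad_chart (tg _ L) (pg _ L) jp ip (@open_cylinder _ _ T i)
  (HJ n) (cylinder_cmap t0 tT ip)).
by move=> x [q iq <-]; rewrite cinvK// hu.
Qed.

End Values.

(** At a fixed point the coefficients of the tensor law do not depend on time. Differentiating its
    (0, 0) component in time gives eps R g_00 computed in either chart, and eps g_00 > 0 is
    cancelled. *)
Lemma scal_indep i j t p : 0 < eps -> 0 < t -> (t%:E < T)%E -> dom i p -> dom j p ->
  scal (g t) i p = scal (g t) j p.
Proof.
move=> eps0 t0 tT ip jp; have [[tg pg _] _] := flow.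
have L := lifespan_interior t0 tT.
pose m c := pd 0 (transition i j c) (cmap i p).
pose G c d r := g r j (cmap j p) c d.
pose sumG r := m 0 * m 0 * G 0 0 r + m 0 * m 1 * G 0 1 r
  + (m 1 * m 0 * G 1 0 r + m 1 * m 1 * G 1 1 r).
have gE r : lifespan T r -> g r i (cmap i p) 0 0 = sumG r.
  by move=> Lr; rewrite (tg _ Lr i j p ip jp) !sum2.
have dG c d : is_derive t 1 (G c d) (- eps * scal (g t) j p * G c d t).
  exact: metric_derive.
have dsum : is_derive t 1 sumG (- eps * scal (g t) j p * sumG t).
  have dZ c d := is_deriveZ (m c * m d) (dG c d).
  have D := is_deriveD (is_deriveD (dZ 0 0) (dZ 0 1)) (is_deriveD (dZ 1 0) (dZ 1 1)).
  by apply: is_derive_eq D _; rewrite /sumG /GRing.scale /=; ring.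
have E : 'D_1 (fun r => g r i (cmap i p) 0 0) t = 'D_1 sumG t.
  apply: near_eq_derive; apply: (near_open (@open_times R T) (conj t0 tT)).
  by move=> r [r0 rT]; apply: gE; exact: lifespan_interior.
have [_ di] := metric_derive 0 0 t0 tT ip; have [_ dj] := dsum.
have [_ g0 _] := positive_definite2 (pg _ L _ _ ip).
move: (etrans (esym di) (etrans E dj)); rewrite -(gE _ L).
move/(mulIf (lt0r_neq0 g0)); apply: mulfI.
by rewrite oppr_eq0 gt_eqF.
Qed.

Definition chart_at (p : M) : chart M := sval (cid (dom_cover p)).

Lemma dom_chart_at p : dom (chart_at p) p.
Proof. exact: svalP (cid (dom_cover p)). Qed.

Lemma harnack_maximum_principle (W : R -> M -> R) (al ga : R) :
  (forall i, exists J, [/\ flow_jets i J,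
     forall t p, 0 < t -> (t%:E < T)%E -> dom i p ->
       val J w (t, cmap i p) = W t p,
     forall z, cyl i z -> val J (der T0 w) z =
       val J k z + al * val J (gradE w w) z + ga * val J w z,
     forall z, cyl i z -> val J k z = al * val J (lapE w) z + eps * val J s z &
     forall t p, 0 < t -> (t%:E < T)%E -> dom i p ->
       spatial_min (jets_at J (t, cmap i p) 5) ->
       val J k (t, cmap i p) < - t^-1 ->
       val J k (t, cmap i p) ^+ 2 <= val J (der T0 k) (t, cmap i p)]) ->
  forall i t p, 0 < t -> (t%:E < T)%E -> dom i p ->
    - t^-1 <= al * lap (g t) i (W t) p + eps * scal (g t) i p.
Proof.
move=> HW.
(* Choosing a chart at every point makes K a function on the surface; [chartK] shows that any other
   chart gives the same value. *)
pose K t p := 'D_1 (W ^~ p) t - al * sqnorm_grad (g t) (chart_at p) (W t) p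
  - ga * W t p.
have chartK i J : flow_jets i J ->
    (forall t p, 0 < t -> (t%:E < T)%E -> dom i p ->
       val J w (t, cmap i p) = W t p) ->
    (forall z, cyl i z -> val J (der T0 w) z =
       val J k z + al * val J (gradE w w) z + ga * val J w z) ->
    forall t p, 0 < t -> (t%:E < T)%E -> dom i p ->
    val J k (t, cmap i p) = K t p.
  move=> FJ WJ wJ t p t0 tT ip; have Cz := cylinder_cmap t0 tT ip.
  have [HJ _ _ _ _] := FJ; have Dw : defined_on (cyl i) J w by [].
  have hW q : dom i q -> W t q = val J w (t, cmap i q) by move=> iq; rewrite WJ.
  have Wt : 'D_1 (W ^~ p) t = val J (der T0 w) (t, cmap i p).
    rewrite -[RHS]/(J 3 1%N 0%N 0%N (t, cmap i p)).
    have [_ <-] := jet_derive_time (HJ 3) 0 0 0 Cz.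
    apply: near_eq_derive; apply: (near_open (@open_times R T) (conj t0 tT)).
    by move=> r [r0 rT]; rewrite -WJ.
  rewrite /K Wt (sqnorm_grad_indep FJ t0 tT ip (dom_chart_at p) (n := 3) hW).
  by rewrite (sqnorm_grad_val FJ t0 tT ip Dw hW) wJ// hW//; ring.
have main t p : 0 < t -> (t%:E < T)%E -> - t^-1 <= K t p.
  move=> t0 tT; apply: (oppV_ge_limit t0) => tau /andP[tau0 taut].
  apply: (@riccati_maximum_principle _ _ T closedM K tau tau0) => // i.
  have [J [FJ WJ wJ kJ Jmin]] := HW i; have [HJ _ _ _ _] := FJ.
  exists (J 5); split; [exact: HJ | exact: chartK FJ WJ wJ |].
  move=> r q tr rT iq rmin Kr; have r0 : 0 < r := lt_trans tau0 tr.
  rewrite -(chartK _ _ FJ WJ wJ r q r0 rT iq) in Kr *; apply: Jmin => //.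
  (* Since tau > 0, the threshold -1/(r - tau) lies below the threshold -1/r at which [Jmin]
     applies. *)
  apply: lt_le_trans Kr _; rewrite lerN2 lef_pV2 ?posrE ?subr_gt0//.
  by rewrite gerBl ltW.
move=> i t p t0 tT ip; have [J [FJ WJ wJ kJ _]] := HW i.
have Dw : defined_on (cyl i) J w by [].
have hW q : dom i q -> W t q = val J w (t, cmap i q) by move=> iq; rewrite WJ.
rewrite (lap_val FJ t0 tT ip Dw hW) (scal_val FJ t0 tT ip) -kJ.
  by rewrite (chartK _ _ FJ WJ wJ t p t0 tT ip); exact: main.
exact: (cylinder_cmap t0 tT ip).
Qed.

(** Slot 3 is filled before slot 5, because the expression for K refers to w. Slot 6 survives, so w
    can still be compared with the logarithm of the function stored there. *)
Lemma harnack_jets i J e (al : R) : flow_jets i J -> defined_on (cyl i) J e ->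
  exists J', [/\ flow_jets i J', J' 6 = J 6,
    forall z, val J' s z = val J s z, forall z, val J' w z = val J e z &
    forall z, val J' k z = al * val J' (lapE w) z + eps * val J' s z].
Proof.
move=> FJ De; pose J1 := upd J 3 e; pose kE := (Cst al * lapE w + Cst eps * s)%X.
have F1 : flow_jets i J1 by apply: flow_jets_upd FJ De; left.
have DkE : defined_on (cyl i) J1 kE.
  have [_ _ _ _ p1] := F1; move=> z Cz; do 2!split=> //.
  by apply: (@defined_lapE R (cyl i) J1 _ w _ z Cz) => // y /p1[].
exists (upd J1 5 kE); split=> //.
by apply: flow_jets_upd F1 DkE; right.
Qed.

(** * The estimate for the logarithm of the scalar curvature *)

Section ScalarCurvature.
Variables (i : chart M) (J : nat -> nat -> nat -> nat -> R * 'rV[R]_2 -> R).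
Hypothesis FJ : flow_jets i J.
Hypothesis wJ : forall z, cyl i z -> val J w z = ln (val J s z).
Hypothesis kJ : forall z, cyl i z ->
  val J k z = eps * val J (lapE w) z + eps * val J s z.

Let s_gt0 z : cyl i z -> 0 < val J s z.
Proof. by have [_ _ _ _ +] := FJ => /[apply] -[]. Qed.

Lemma ln_scal_equation z : cyl i z -> val J (der T0 w) z =
  val J k z + eps * val J (gradE w w) z + 0 * val J w z.
Proof.
move=> Cz; have [HJ _ fJ sJ pJ] := FJ; have oC := @open_cylinder _ _ T i.
have dJ y : cyl i y -> 0 < val J (detE R) y by move=> /pJ[].
have Dln : defined_on (cyl i) J (Ln s) by move=> y Cy; split=> //; exact: s_gt0.
have Dw : defined_on (cyl i) J w by [].
have wln y : cyl i y -> val J w y = val J (Ln s) y by exact: wJ.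
rewrite (val_der_eq oC HJ T0 Dw Dln wln Cz) kJ//.
rewrite (ln_scal_heat oC HJ dJ fJ sJ (s_gt0 Cz) Cz) (lapE_eq oC HJ Dw Dln wln Cz).
rewrite (gradE_eq oC HJ w Dw Dln wln Cz) [val J (gradE w _) z]grad_sym.
by rewrite (gradE_eq oC HJ (Ln s) Dw Dln wln Cz); ring.
Qed.

Lemma ln_scal_at_min z : cyl i z -> spatial_min (jets_at J z 5) ->
  val J k z ^+ 2 <= val J (der T0 k) z.
Proof.
move=> Cz zmin; have [HJ _ fJ sJ pJ] := FJ.
have aJ y : cyl i y -> 0 < val J g11 y by move=> /pJ[].
have dJ y : cyl i y -> 0 < val J (detE R) y by move=> /pJ[].
exact: (harnack_scal_at_min (@open_cylinder _ _ T i) HJ eps_ge0 aJ dJ fJ sJ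
  ln_scal_equation kJ erefl erefl s_gt0 wJ Cz zmin).
Qed.

End ScalarCurvature.

Lemma scal_harnack i J t p : 0 < eps -> flow_jets i J -> 0 < t -> (t%:E < T)%E ->
  dom i p ->
  - t^-1 <= eps * (val J (lapE (Ln s)) (t, cmap i p) + val J s (t, cmap i p)).
Proof.
move=> eps0 FJ t0 tT ip; rewrite mulrDr.
pose W r q := ln (scal (g r) (chart_at q) q).
have WE j J' r q : flow_jets j J' -> 0 < r -> (r%:E < T)%E -> dom j q ->
    W r q = ln (val J' s (r, cmap j q)).
  move=> FJ' r0 rT jq; rewrite /W -(scal_val FJ' r0 rT jq).
  by rewrite (scal_indep eps0 r0 rT (dom_chart_at q) jq).
have := @harnack_maximum_principle W eps 0 _ i t p t0 tT ip.
have [_ _ _ _ pJ] := FJ.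
have Dln : defined_on (cyl i) J (Ln s) by move=> y Cy; split=> //; have [] := pJ y Cy.
rewrite (lap_val FJ t0 tT ip Dln); last by move=> q iq; exact: WE.
rewrite (scal_val FJ t0 tT ip); apply=> j.
(* A component of the metric serves as filler for the free slots. *)
have [F HF _] := metric_jets j 0 0; have [J0 FJ0 _] := flow_jets_exist HF.
have [_ _ _ _ p0] := FJ0.
have Dln0 : defined_on (cyl j) J0 (Ln s).
  by move=> y Cy; split=> //; have [] := p0 y Cy.
have [J1 [FJ1 _ s1 w1 k1]] := harnack_jets eps FJ0 Dln0.
have wJ1 z : cyl j z -> val J1 w z = ln (val J1 s z) by rewrite w1 s1.
exists J1; split=> //.
- by move=> r q r0 rT jq; rewrite wJ1 ?(WE j J1)//; exact: (cylinder_cmap r0 rT jq).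
- exact: (ln_scal_equation FJ1 wJ1 (fun y _ => k1 y)).
- move=> r q r0 rT jq zmin _.
  exact: (ln_scal_at_min FJ1 wJ1 (fun y _ => k1 y)
    (cylinder_cmap r0 rT jq) zmin).
Qed.

(** * The estimate for the logarithm of the heat solution *)

Section Heat.
Variable f : R -> M -> R.
Hypothesis f_gt0 : forall t, lifespan T t -> forall p : M, 0 < f t p.
Hypothesis f_heat : heat_solution T eps g f.

(** Dividing the heat equation by f and using Lap f / f = Lap ln f + |d ln f|^2 gives the equation
    for w = ln f with al = 1 and ga = -1. *)
Lemma heat_jets i : exists J, [/\ flow_jets i J,
  forall t p, 0 < t -> (t%:E < T)%E -> dom i p ->
    val J w (t, cmap i p) = ln (f t p),
  forall z, cyl i z -> val J (der T0 w) z =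
    val J k z + 1 * val J (gradE w w) z + (-1) * val J w z &
  forall z, cyl i z -> val J k z = 1 * val J (lapE w) z + eps * val J s z].
Proof.
have [sf fE] := f_heat; have oC := @open_cylinder _ _ T i.
pose fi (z : R * 'rV[R]_2) := f z.1 (cinv i z.2).
have [F HF FE] : exists2 F, jet_family (cyl i) F & F 0 0 0 = fi.
  apply: (smooth_jets oC); apply: (smooth_on_open oC _ (sf i)).
  by move=> z [z0 zT iz]; split=> //; exact: lifespan_interior.
have [J0 FJ0 J0F] := flow_jets_exist HF; pose u : expr R := Jet 6 0 0 0.
have u_val J t p : J 6 = J0 6 -> dom i p -> val J u (t, cmap i p) = f t p.
  by move=> J6 ip; rewrite /val /= /jets_at J6 J0F FE /fi /= cinvK.
have u_gt0 J : J 6 = J0 6 -> forall z, cyl i z -> 0 < val J u z.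
  move=> J6 z Cz; have [p ip zp] := cylinder_point Cz; have [z0 zT _] := Cz.
  by rewrite (surjective_pairing z) zp u_val//; exact: f_gt0 (lifespan_interior z0 zT) p.
have Dln J : J 6 = J0 6 -> defined_on (cyl i) J (Ln u).
  by move=> J6 z Cz; split=> //; exact: u_gt0.
have [J [FJ J6 _ w_ k_]] := harnack_jets 1 FJ0 (Dln J0 erefl).
have wln z : val J w z = val J (Ln u) z.
  by rewrite w_ /val /= /jets_at J6.
exists J; split=> // [t p t0 tT ip|z Cz].
  by rewrite wln -(u_val J t p J6 ip).
have [HJ _ _ _ pJ] := FJ.
have dJ y : cyl i y -> 0 < val J (detE R) y by move=> /pJ[].
have [p ip zp] := cylinder_point Cz; have [z0 zT _] := Cz.
have L := lifespan_interior z0 zT.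
have zE : z = (z.1, cmap i p) by rewrite -zp -surjective_pairing.
have Cz' : cyl i (z.1, cmap i p) by rewrite -zE.
have Dw : defined_on (cyl i) J w by [].
have Du : defined_on (cyl i) J u by [].
have {}wln y : cyl i y -> val J w y = val J (Ln u) y by [].
have hu q : dom i q -> f z.1 q = val J u (z.1, cmap i q) by move=> iq; rewrite u_val.
have ut : val J (der T0 u) z = val J (lapE u) z - val J u z * ln (val J u z)
    + eps * val J s z * val J u z.
  have d := jet_derive_time (HJ 6) 0 0 0 Cz'.
  have fF : (fun r => J 6 0 0 0 (r, cmap i p)) = f ^~ p.
    by apply/funext => r; exact: (u_val J r p).
  rewrite {}fF in d; have := dt_interior z0 zT d; rewrite (fE _ L i p ip).
  rewrite (lap_val FJ z0 zT ip Du hu) (scal_val FJ z0 zT ip) hu// -zE.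
  by move=> ->.
rewrite (val_der_eq oC HJ T0 Dw (Dln J J6) wln Cz) k_ (lapE_eq oC HJ Dw (Dln J J6) wln Cz).
rewrite (gradE_eq oC HJ w Dw (Dln J J6) wln Cz) [val J (gradE w _) z]grad_sym.
rewrite (gradE_eq oC HJ (Ln u) Dw (Dln J J6) wln Cz).
have u0 := u_gt0 J J6 z Cz.
rewrite (lap_ln dJ u0 Cz) (grad_ln dJ _ u0 Cz) grad_sym (grad_ln dJ _ u0 Cz) wln//.
have -> : val J (der T0 (Ln u)) z = val J (der T0 u) z / val J u z by [].
have -> : val J (Ln u) z = ln (val J u z) by [].
by rewrite ut; field; exact: lt0r_neq0.
Qed.

Lemma heat_harnack i t p : 0 < t -> (t%:E < T)%E -> dom i p ->
  - t^-1 <= lap (g t) i (fun q => ln (f t q)) p + eps * scal (g t) i p.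
Proof.
move=> t0 tT ip; rewrite -[lap _ _ _ _]mul1r.
apply: (@harnack_maximum_principle (fun r q => ln (f r q)) 1 (-1)) => // {t0 tT ip}i.
have [J [FJ WJ wJ kJ]] := heat_jets i.
exists J; split=> // {}t {}p t0 tT ip zmin Kt.
have Cz := cylinder_cmap t0 tT ip; have [HJ _ fJ sJ pJ] := FJ.
have aJ y : cyl i y -> 0 < val J g11 y by move=> /pJ[].
have dJ y : cyl i y -> 0 < val J (detE R) y by move=> /pJ[].
have [_ _ s0] := pJ _ Cz.
have k0 : val J k (t, cmap i p) <= 0.
  by apply: ltW; apply: lt_trans Kt _; rewrite oppr_lt0 invr_gt0.
apply: (harnack_heat_at_min (@open_cylinder _ _ T i) HJ ler01 aJ dJ fJ sJ wJ kJ
  eps_ge0 erefl erefl s0 Cz zmin k0).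
(* For eps > 0 the estimate for ln R gives K < -1/t <= Q. For eps = 0 the required bound is K <= 0,
   which is [k0]. *)
have [eps0|] := ltP 0 eps.
  by apply: le_trans (ltW Kt) _; exact: scal_harnack.
move=> eps0; have -> : eps = 0 by apply/eqP; rewrite eq_le eps0.
by rewrite mul0r.
Qed.

Lemma ln_heat_equation i t p : 0 < t -> (t%:E < T)%E -> dom i p ->
  dt T (fun r => ln (f r p)) t - sqnorm_grad (g t) i (fun q => ln (f t q)) p
    + ln (f t p) =
  lap (g t) i (fun q => ln (f t q)) p + eps * scal (g t) i p.
Proof.
move=> t0 tT ip; have [J [FJ WJ wJ kJ]] := heat_jets i.
have Cz := cylinder_cmap t0 tT ip; have [HJ _ _ _ _] := FJ.
have Dw : defined_on (cyl i) J w by [].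
have hW q : dom i q -> ln (f t q) = val J w (t, cmap i q) by move=> iq; rewrite WJ.
rewrite (lap_val FJ t0 tT ip Dw hW) (sqnorm_grad_val FJ t0 tT ip Dw hW).
rewrite (scal_val FJ t0 tT ip) hW//.
have d : is_derive t 1 (fun r => ln (f r p)) (val J (der T0 w) (t, cmap i p)).
  apply: near_eq_is_derive (jet_derive_time (HJ 3) 0 0 0 Cz).
  apply: (near_open (@open_times R T) (conj t0 tT)) => r [r0 rT].
  exact: WJ.
by rewrite (dt_interior t0 tT d) wJ// kJ//; ring.
Qed.

Lemma lap_opp_ln i t p : 0 < t -> (t%:E < T)%E -> dom i p ->
  lap (g t) i (fun q => - ln (f t q)) p = - lap (g t) i (fun q => ln (f t q)) p.
Proof.
move=> t0 tT ip; have [J [FJ WJ _ _]] := heat_jets i.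
have Dw : defined_on (cyl i) J w by [].
have hW q : dom i q -> ln (f t q) = val J w (t, cmap i q) by move=> iq; rewrite WJ.
have DNw : defined_on (cyl i) J (- w)%X by [].
have hNW q : dom i q -> - ln (f t q) = val J (- w)%X (t, cmap i q).
  by move=> iq; rewrite hW.
rewrite (lap_val FJ t0 tT ip Dw hW) (lap_val FJ t0 tT ip DNw hNW).
by rewrite /val /=; ring.
Qed.

End Heat.

End Harnack.

Theorem theorem1p1 (R : realType) (eps : R) (eps_ge0 : 0 <= eps)
    (M : surface R) (closedM : closed_surface M)
    (T : \bar R) (T_gt0 : (0 < T)%E)
    (g : R -> tensor M) (flow : eps_ricci_flow T eps g)
    (scal_gt0 : forall t, lifespan T t -> forall (i : chart M) (p : M),
       dom i p -> 0 < scal (g t) i p)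
    (f : R -> M -> R)
    (f_gt0 : forall t, lifespan T t -> forall p : M, 0 < f t p)
    (f_heat : heat_solution T eps g f)
    (t : R) (t_gt0 : 0 < t) (t_ltT : (t%:E < T)%E)
    (i : chart M) (p : M) (dom_p : dom i p) :
  let u : M -> R := fun q => - ln (f t q) in
  let H : R := lap (g t) i u p - eps * scal (g t) i p in
  let lnf : R -> M -> R := fun s q => ln (f s q) in
  H <= 1 / t /\
  (dt T (fun s => lnf s p) t - sqnorm_grad (g t) i (lnf t) p + lnf t p + 1 / t
     = lap (g t) i (lnf t) p + eps * scal (g t) i p + 1 / t /\
   0 <= lap (g t) i (lnf t) p + eps * scal (g t) i p + 1 / t).
Proof.
have key := heat_harnack eps_ge0 closedM flow scal_gt0 f_gt0 f_heat t_gt0 t_ltT dom_p.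
move=> u H lnf; rewrite div1r; split; last split.
- rewrite /H /u (lap_opp_ln flow scal_gt0 f_gt0 f_heat t_gt0 t_ltT dom_p).
  by move: key; lra.
- by rewrite -(ln_heat_equation flow scal_gt0 f_gt0 f_heat t_gt0 t_ltT dom_p).
- by move: key; rewrite /lnf; lra.
Qed.
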